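(* The morphism of $\mathfrak{S}$-modules $\lambda=\psi\circ\theta:\mathrm{CycLie}\to\mathrm{PreLie}_{v=1}\subset\mathrm{PreLie}$ is injective.
   Context: All vector spaces are over $\mathbb{Q}$. An $\mathfrak{S}$-module is a functor from the groupoid of finite sets (and bijections) to $\mathbb{Q}$-vector spaces. $(P\otimes Q)(I)=\bigoplus_{I=J\sqcup K}P(J)\otimes Q(K)$; $S^2$ and $\Lambda^2$ denote symmetric and exterior squares for this tensor product (usual flip, no extra signs); $(P\odot Q)(I)=P(I)\otimes Q(I)$. $\mathrm{Lie}$ is the operad of Lie algebras. $\mathrm{CycLie}$ (cyclic Lie module, or Whitehouse module) is the right $\mathrm{Lie}$-module $S^2\mathrm{Lie}/K_L$, where $K_L$ is the sub-right-$\mathrm{Lie}$-module generated by the relation $([x,y],z)=(x,[y,z])$, $(u,v)$ denoting the class of the symmetric product $uv$. Known fact: for $\ell\in\mathrm{CycLie}(I)$ and $i\in I$ there is a unique $\ell_i\in\mathrm{Lie}(I\setminus\{i\})$ with $\ell=(i,\ell_i)$. $\mathrm{PreLie}$ is the operad of pre-Lie algebras (product $\triangleleft$ with $(x\triangleleft y)\triangleleft z-x\triangleleft(y\triangleleft z)=(x\triangleleft z)\triangleleft y-x\triangleleft(z\triangleleft y)$). $\mathrm{PreLie}(I)$ has as basis the rooted trees with vertex set $I$, and $S\triangleleft T$ is the sum of all rooted trees obtained from $S\sqcup T$ by adding an edge from the root of $T$ to a vertex of $S$, rooted at the root of $S$. $\mathrm{PreLie}_{v=1}$ is the sub-$\mathfrak{S}$-module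 spanned by rooted trees whose root is adjacent to exactly one edge. $\varphi:\mathrm{Lie}\to\mathrm{PreLie}$ is the injective morphism of operads given by $[x,y]\mapsto x\triangleleft y-y\triangleleft x$. $\mathrm{CycPreLie}$ is the right $\mathrm{PreLie}$-module $\Lambda^2\mathrm{PreLie}/K_P$, where $K_P$ is the sub-right-$\mathrm{PreLie}$-module generated by the relations (writing $\langle r,s\rangle$ for the class of $r\wedge s$) $\langle x,y\triangleleft z\rangle=-\langle z,y\triangleleft x\rangle$ and $\langle x,y\triangleleft z\rangle=\langle y,x\triangleleft z-z\triangleleft x\rangle$. Known fact: for $t\in\mathrm{CycPreLie}(I)$ and $i\in I$ there is a unique $\Gamma_i(t)\in\mathrm{PreLie}(I\setminus\{i\})$ with $t=\langle i,\Gamma_i(t)\rangle$. $\mathrm{Perm}(I)=\mathbb{Q}I$ (vector space with basis $I$). The map $\theta:\mathrm{CycLie}\to\mathrm{Perm}\odot\mathrm{CycPreLie}$: for $\ell\in S^2\mathrm{Lie}(I)$, decompose its image in $S^2\mathrm{PreLie}$ according to the roots of the trees, $S^2\varphi(\ell)=\sum_{a,b}\mathbf{c}_{a,b}T_aT_b$, where $T_a$ denotes a tree with root $a$ (several trees with the same root may occur, the sum runs over all of them), and set $\theta(\ell)=\sum_{a,b}\mathbf{c}_{a,b}\,(a-b)\otimes\langle T_a,T_b\rangle$; this passes to the quotient $\mathrm{CycLie}$ (as established in the paper). The map $\psi:\mathrm{Perm}\odot\mathrm{CycPreLie}\to\mathrm{PreLie}_{v=1}$ is $\psi(a\otimes t)=a\triangleleft\Gamma_a(t)$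 for $t\in\mathrm{CycPreLie}(I)$, $a\in I$, where $a$ also denotes the one-vertex tree on $\{a\}$. *)

(* Defs.v *)
From HB Require Import structures.
From mathcomp Require Import all_boot all_order all_algebra.
From mathcomp Require Import boolp classical_sets freeg lra.

Set Implicit Arguments.
Unset Strict Implicit.
Unset Printing Implicit Defensive.

Import GRing.Theory.
Local Open Scope ring_scope.
Local Open Scope quotient_scope.

Section Span.
Variables (V : lmodType rat) (G : set V).

Inductive lspan : V -> Prop :=
| lspan_0 : lspan 0
| lspan_cons a g x : G g -> lspan x -> lspan (a *: g + x).

Lemma lspan_gen g : G g -> lspan g.
Proof.
by move=> Gg; rewrite -[g]scale1r -[_ *: _]addr0; apply: lspan_cons lspan_0.
Qed.

Lemma lspanD x y : lspan x -> lspan y -> lspan (x + y).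
Proof.
move=> Gx Gy; elim: Gx => [|a g z Gg _ IH]; first by rewrite add0r.
by rewrite -addrA; apply: lspan_cons.
Qed.

Lemma lspanZ a x : lspan x -> lspan (a *: x).
Proof.
elim=> [|b g z Gg _ IH]; first by rewrite scaler0; apply: lspan_0.
by rewrite scalerDr scalerA; apply: lspan_cons.
Qed.

Lemma lspan_sum (J : Type) (r : seq J) (P : pred J) (F : J -> V) :
  (forall j, P j -> lspan (F j)) -> lspan (\sum_(j <- r | P j) F j).
Proof. by apply: big_ind; [apply: lspan_0 | apply: lspanD]. Qed.

Lemma lspan_lin (W : lmodType rat) (f : V -> W) (H : set W) : linear f ->
  H 0 -> (forall a u v, H u -> H v -> H (a *: u + v)) ->
  (forall g, G g -> H (f g)) -> forall x, lspan x -> H (f x).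
Proof.
move=> fL H0 HD HG x; elim=> [|a g z Gg _ IH].
  by have := fL (-1) 0 0; rewrite scaler0 addr0 scaleN1r addNr => ->.
by rewrite fL; apply: HD => //; apply: HG.
Qed.

Definition lspanb (x : V) : bool := `[< lspan x >].

Lemma lspanb_zmod_closed : zmod_closed lspanb.
Proof.
split=> [|x y /asboolP Gx /asboolP Gy]; apply/asboolP; first exact: lspan_0.
by rewrite -scaleN1r; apply: lspanD => //; apply: lspanZ.
Qed.

HB.instance Definition _ := GRing.isZmodClosed.Build V lspanb lspanb_zmod_closed.

End Span.

Section Quotient.
Variables (V : lmodType rat) (G : set V).

(** The quotient of [V] by the linear span of [G]. *)
Definition lquot : Type := Quotient.quot (GRing.ZmodClosed.clone V (lspanb G) _).

HB.instance Definition _ := GRing.Zmodule.on lquot.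
HB.instance Definition _ := Choice.on lquot.

Definition lclass (x : V) : lquot := \pi_(Quotient.quot (GRing.ZmodClosed.clone V (lspanb G) _)) x.
Definition lrepr (x : lquot) : V := repr (x : Quotient.quot (GRing.ZmodClosed.clone V (lspanb G) _)).

Lemma lreprK x : lclass (lrepr x) = x.
Proof. exact: reprK. Qed.

Lemma lclassE x y : lclass x = lclass y <-> lspan G (x - y).
Proof.
rewrite (_ : lspan G (x - y) <-> (x - y) \in lspanb G); last first.
  by split=> [/asboolP|/asboolP].
by rewrite Quotient.idealrBE; split=> [/eqP|/eqP].
Qed.

Lemma lclass_is_zmod : zmod_morphism lclass.
Proof. by move=> x y; rewrite /lclass; exact: (raddfB (\pi_(Quotient.quot (GRing.ZmodClosed.clone V (lspanb G) _)))). Qed.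

Lemma lrepr_class x : lspan G (lrepr (lclass x) - x).
Proof. by apply/lclassE; rewrite lreprK. Qed.

Definition lquot_scale (a : rat) (x : lquot) := lclass (a *: lrepr x).

Lemma lclass_scale a x : lclass (a *: x) = lquot_scale a (lclass x).
Proof.
apply/lclassE; rewrite -scalerBr; apply: lspanZ.
by rewrite -opprB -scaleN1r; apply/lspanZ/lrepr_class.
Qed.

Lemma lclassD x y : lclass (x + y) = lclass x + lclass y.
Proof.
have lN u : lclass (- u) = - lclass u.
  have := lclass_is_zmod 0 u; rewrite sub0r => ->.
  by have := lclass_is_zmod 0 0; rewrite !subrr => ->; rewrite sub0r.
by rewrite -[y]opprK lclass_is_zmod [in RHS]lN.
Qed.

Lemma lquot_scaleA a b x :
  lquot_scale a (lquot_scale b x) = lquot_scale (a * b) x.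
Proof. by rewrite -[x]lreprK -!lclass_scale scalerA. Qed.

Lemma lquot_scale1 : left_id 1 lquot_scale.
Proof. by move=> x; rewrite -[x]lreprK -lclass_scale scale1r. Qed.

Lemma lquot_scaleDr : right_distributive lquot_scale +%R.
Proof.
move=> a x y; rewrite -[x]lreprK -[y]lreprK -lclassD -!lclass_scale.
by rewrite scalerDr lclassD.
Qed.

Lemma lquot_scaleDl x : {morph lquot_scale^~ x : a b / a + b}.
Proof. by move=> a b; rewrite -[x]lreprK -!lclass_scale -lclassD scalerDl. Qed.

HB.instance Definition _ := GRing.Zmodule_isLmodule.Build rat lquot
  lquot_scaleA lquot_scale1 lquot_scaleDr lquot_scaleDl.

Lemma lclass_is_linear : linear lclass.
Proof. by move=> a x y; rewrite lclassD lclass_scale. Qed.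

HB.instance Definition _ := GRing.isLinear.Build rat V lquot _ lclass
  lclass_is_linear.

Lemma lclass_eq0 x : lclass x = 0 <-> lspan G x.
Proof. by rewrite -(linear0 lclass) lclassE subr0. Qed.

Lemma lclass_gen x : G x -> lclass x = 0.
Proof. by move=> Gx; apply/lclass_eq0/lspan_gen. Qed.

Variables (W : lmodType rat) (f : {linear V -> W}).
Hypothesis f0 : forall g, G g -> f g = 0.

(** The linear map induced on the quotient by a map that vanishes on [G]. *)
Definition llift of (forall g, G g -> f g = 0) := fun x : lquot => f (lrepr x).

Lemma lliftE x : llift f0 (lclass x) = f x.
Proof.
apply/eqP; rewrite -subr_eq0 -linearB /=; apply/eqP.
move: (_ - _) (lrepr_class x).
apply: (lspan_lin (H := [set 0]) (linearP f)) => //= a u v -> ->.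
by rewrite scaler0 addr0.
Qed.

Lemma llift_is_linear : linear (llift f0).
Proof.
move=> a x y; rewrite -[x]lreprK -[y]lreprK -linearP !lliftE; exact: linearP.
Qed.

HB.instance Definition _ := GRing.isLinear.Build rat lquot W _ (llift f0)
  llift_is_linear.

End Quotient.

Section FreeModule.
Variables (K : choiceType) (W : lmodType rat) (f : K -> W).

Lemma freeg_ind (P : {freeg K / rat} -> Prop) :
  P 0 -> (forall a k x, P x -> P (a *: << k >> + x)) -> forall x, P x.
Proof.
move=> P0 PD x; rewrite -[x]freeg_sumE.
elim: (dom x) => [|k s IH]; first by rewrite big_nil.
rewrite big_cons (_ : << _ *g k >> = coeff k x *: << k >>); first exact: PD.
by apply/eqP/freeg_eqP => z; rewrite coeffZ !coeffU mul1r.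
Qed.

Lemma fglift_is_zmod : zmod_morphism (fglift f).
Proof. exact: lift_is_additive. Qed.

Lemma fglift_is_linear : linear (fglift f).
Proof.
have lD x y : fglift f (x + y) = fglift f x + fglift f y.
  have lN u : fglift f (- u) = - fglift f u.
    have := fglift_is_zmod 0 u; rewrite sub0r => ->.
    by have := fglift_is_zmod 0 0; rewrite !subrr => ->; rewrite sub0r.
  by rewrite -[y]opprK fglift_is_zmod [in RHS]lN.
have lU a k : fglift f (a *: << k >>) = a *: f k.
  rewrite (_ : a *: << k >> = << a *g k >>); first exact: liftU.
  by apply/eqP/freeg_eqP => z; rewrite coeffZ !coeffU mul1r.
move=> a x y; rewrite lD; congr (_ + _).
elim/freeg_ind: x => [|b k x IH].
  by rewrite scaler0 -[0](subrr 0) fglift_is_zmod subrr scaler0.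
by rewrite scalerDr !lD scalerA !lU IH scalerDr scalerA.
Qed.

Lemma freeg_linear_eq (g h : {freeg K / rat} -> W) :
  linear g -> linear h -> (forall k, g << k >> = h << k >>) -> g =1 h.
Proof.
have l0 (g' : {freeg K / rat} -> W) : linear g' -> g' 0 = 0.
  by move=> /(_ (-1) 0 0); rewrite scaler0 addr0 scaleN1r addNr.
move=> gL hL gh; elim/freeg_ind => [|a k x IH]; first by rewrite !l0.
by rewrite gL hL gh IH.
Qed.

HB.instance Definition _ := GRing.isLinear.Build rat {freeg K / rat} W _
  (fglift f) fglift_is_linear.

Lemma fglift1 k : fglift f << k >> = f k.
Proof. by rewrite liftU scale1r. Qed.

End FreeModule.

Section FreeBilinear.
Variables (K L : choiceType) (W : lmodType rat) (f : K -> L -> W).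

Definition fglift2 (x : {freeg K / rat}) (y : {freeg L / rat}) : W :=
  fglift (fun k => fglift (f k) y) x.

Lemma fglift2_is_bilinear : bilinear_for *:%R *:%R fglift2.
Proof.
split=> [y|x] a u v; first exact: linearP.
rewrite /fglift2; elim/freeg_ind: x => [|b k x IH].
  by rewrite !linear0 /= scaler0 addr0.
rewrite !linearP /= !fglift1 linearP IH /= !scalerDr !scalerA -!addrA (mulrC b).
by congr (_ + _); rewrite addrCA.
Qed.

HB.instance Definition _ := bilinear_isBilinear.Build rat {freeg K / rat}
  {freeg L / rat} W *:%R *:%R fglift2 fglift2_is_bilinear.

Lemma fglift2_1 k l : fglift2 << k >> << l >> = f k l.
Proof. by rewrite /fglift2 !fglift1. Qed.

End FreeBilinear.

Section Square.
Variables (eps : rat) (V : lmodType rat).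

Inductive sqrel : set {freeg (V * V)%type / rat} :=
| sqrel_linl a x y z :
    sqrel (<< (a *: x + y, z) >> - a *: << (x, z) >> - << (y, z) >>)
| sqrel_linr a x y z :
    sqrel (<< (z, a *: x + y) >> - a *: << (z, x) >> - << (z, y) >>)
| sqrel_sym x y : sqrel (<< (x, y) >> - eps *: << (y, x) >>).

(** [V (x) V] modulo [x (x) y = eps *: (y (x) x)]: the symmetric square when
    [eps = 1], the exterior square when [eps = -1]. *)
Definition sq : Type := lquot sqrel.

HB.instance Definition _ := GRing.Lmodule.on sq.

Definition sqmul (x y : V) : sq := lclass sqrel << (x, y) >>.

Lemma sqmul_is_bilinear : bilinear_for *:%R *:%R sqmul.
Proof.
split=> z a x y; apply/eqP; rewrite -subr_eq0 opprD addrA.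
  have /lclass_gen := sqrel_linl a x y z.
  by rewrite !linearB linearZ => /eqP.
have /lclass_gen := sqrel_linr a x y z.
by rewrite !linearB linearZ => /eqP.
Qed.

HB.instance Definition _ := bilinear_isBilinear.Build rat V V sq *:%R *:%R
  sqmul sqmul_is_bilinear.

Lemma sqmulC x y : sqmul x y = eps *: sqmul y x.
Proof.
apply/eqP; rewrite -subr_eq0.
have /lclass_gen := sqrel_sym x y.
by rewrite !linearB linearZ => /eqP.
Qed.

Variables (W : lmodType rat) (f : {bilinear V -> V -> W}).
Hypothesis fC : forall x y, f x y = eps *: f y x.

Lemma sqlift_subproof g :
  sqrel g -> fglift (fun p : V * V => f p.1 p.2) g = 0.
Proof.
case=> [a x y z|a x y z|x y]; rewrite !linearB ?linearZ /= !fglift1 /=.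
- by rewrite linearPl /= addrAC addrK scalerN subrr.
- by rewrite linearPr /= addrAC addrK scalerN subrr.
- by rewrite scalerN -fC subrr.
Qed.

Definition sqlift : sq -> W :=
  llift sqlift_subproof.

HB.instance Definition _ := GRing.Linear.copy sqlift (llift sqlift_subproof).

Lemma sqliftE x y : sqlift (sqmul x y) = f x y.
Proof. by rewrite /sqlift lliftE /= fglift1. Qed.

End Square.

Section SquareMap.
Variables (eps : rat) (V W : lmodType rat) (f : {linear V -> W}).

Definition sqmapmul (x y : V) : sq eps W := sqmul eps (f x) (f y).

Lemma sqmapmul_is_bilinear : bilinear_for *:%R *:%R sqmapmul.
Proof. by split=> [z|z] a x y; rewrite /sqmapmul linearP ?linearPl ?linearPr. Qed.

HB.instance Definition _ := bilinear_isBilinear.Build rat V V (sq eps W)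
  *:%R *:%R sqmapmul sqmapmul_is_bilinear.

Lemma sqmapmulC x y : sqmapmul x y = eps *: sqmapmul y x.
Proof. exact: sqmulC. Qed.

Definition sqmap : sq eps V -> sq eps W := sqlift sqmapmulC.

HB.instance Definition _ := GRing.Linear.copy sqmap (sqlift sqmapmulC).

Lemma sqmapE x y : sqmap (sqmul eps x y) = sqmul eps (f x) (f y).
Proof. exact: sqliftE. Qed.

End SquareMap.

Inductive bracketing (I : Type) :=
| BLeaf of I
| BNode of bracketing I & bracketing I.

Section BracketingChoice.
Variable I : choiceType.

Fixpoint bracketing_encode (t : bracketing I) : GenTree.tree I :=
  match t with
  | BLeaf i => GenTree.Leaf i
  | BNode t u =>
      GenTree.Node 0 [:: bracketing_encode t; bracketing_encode u]
  end.

Fixpoint bracketing_decode (t : GenTree.tree I) : option (bracketing I) :=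
  match t with
  | GenTree.Leaf i => Some (BLeaf i)
  | GenTree.Node _ [:: t; u] =>
      if (bracketing_decode t, bracketing_decode u) is (Some t', Some u')
      then Some (BNode t' u') else None
  | _ => None
  end.

Lemma bracketing_encodeK : pcancel bracketing_encode bracketing_decode.
Proof. by elim=> //= t -> u ->. Qed.

HB.instance Definition _ := Choice.copy (bracketing I)
  (pcan_type bracketing_encodeK).

End BracketingChoice.

Fixpoint leaves (I : Type) (t : bracketing I) : seq I :=
  match t with
  | BLeaf i => [:: i]
  | BNode t u => leaves t ++ leaves u
  end.

Section Lie.
Variable I : finType.

Definition magma := {freeg (bracketing I) / rat}.

Definition magma_mul : magma -> magma -> magma :=
  fglift2 (fun t u => << BNode t u >>).

HB.instance Definition _ := Bilinear.copy magma_mul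
  (fglift2 (fun t u : bracketing I => << BNode t u >> : magma)).

(** The generators, as a vector space, of the two-sided ideal of antisymmetry
    and of the Jacobi identity. *)
Inductive lie_rel : set magma :=
| lie_anti x y : lie_rel (magma_mul x y + magma_mul y x)
| lie_jacobi x y z :
    lie_rel (magma_mul x (magma_mul y z) + magma_mul y (magma_mul z x)
             + magma_mul z (magma_mul x y))
| lie_mull x r : lie_rel r -> lie_rel (magma_mul x r)
| lie_mulr x r : lie_rel r -> lie_rel (magma_mul r x).

Definition free_lie : Type := lquot lie_rel.

HB.instance Definition _ := GRing.Lmodule.on free_lie.

Definition lie_class : magma -> free_lie := lclass lie_rel.

HB.instance Definition _ := GRing.Linear.copy lie_class (lclass lie_rel).

Definition lie_bracket (x y : free_lie) : free_lie :=
  lie_class (magma_mul (lrepr x) (lrepr y)).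

Lemma lie_span_mull x r : lspan lie_rel r -> lspan lie_rel (magma_mul x r).
Proof.
move: r; apply: (lspan_lin (linearPr magma_mul x)); first exact: lspan_0.
  by move=> a u v lu lv; apply: lspanD => //; apply: lspanZ.
by move=> g lg; apply/lspan_gen/lie_mull.
Qed.

Lemma lie_span_mulr x r : lspan lie_rel r -> lspan lie_rel (magma_mul r x).
Proof.
move: r; apply: (lspan_lin (f := magma_mul^~ x)); first 1 last.
- exact: lspan_0.
- by move=> a u v lu lv; apply: lspanD => //; apply: lspanZ.
- by move=> g lg; apply/lspan_gen/lie_mulr.
by move=> a u v; exact: (linearPl magma_mul).
Qed.

Lemma lie_bracketE x y :
  lie_bracket (lie_class x) (lie_class y) = lie_class (magma_mul x y).
Proof.
apply/lclassE; set x' := lrepr _; set y' := lrepr _.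
rewrite (_ : _ - _ = magma_mul (x' - x) y' + magma_mul x (y' - y)).
  apply: lspanD; first by apply/lie_span_mulr/lrepr_class.
  by apply/lie_span_mull/lrepr_class.
by rewrite linearBl linearBr /= addrA subrK.
Qed.

(** The operad Lie: [Lie J] is the multilinear part of the free Lie algebra on
    the set [J], that is the span of the bracketings in which each element of
    [J] appears exactly once and no other element appears. *)
Definition multilinear (J : {set I}) (t : bracketing I) : bool :=
  uniq (leaves t) && ([set i in leaves t] == J).

Definition Lie (J : {set I}) : set free_lie :=
  lspan [set lie_class << t >> | t in [set t | multilinear J t]].

Definition set_partition3 (A B C : {set I}) : Prop :=
  [/\ A :|: B :|: C = [set: I]%SET, [disjoint A & B], [disjoint A & C]
    & [disjoint B & C]].

(** As [free_lie] is graded by the multiplicities of the elements of [I], the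
    symmetric square of [Lie], evaluated at [I], is the subspace of
    [sq 1 free_lie] spanned by the products of an element of [Lie J] and an
    element of [Lie (~: J)].

    The elements [([x,y],z) - (x,[y,z])] for all [x], [y], [z] in Lie with [I]
    the disjoint union of their arities, that is the substitutions of elements of
    Lie in the defining relation of CycLie: they span the sub-right-module
    [K_L(I)]. *)
Inductive K_L : set (sq 1 free_lie) :=
| K_L_intro A B C x y z of set_partition3 A B C & Lie A x & Lie B y & Lie C z :
    K_L (sqmul 1 (lie_bracket x y) z - sqmul 1 x (lie_bracket y z)).

Definition cyc_lie : Type := lquot K_L.

HB.instance Definition _ := GRing.Lmodule.on cyc_lie.

Definition cyc_lie_pair (x y : free_lie) : cyc_lie := lclass K_L (sqmul 1 x y).

(** [CycLie], evaluated at [I], is the image in [cyc_lie] of the symmetric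
    square of [Lie]. *)
Definition CycLie : set cyc_lie :=
  lspan [set c | exists J x y,
           [/\ Lie J x, Lie (~: J)%SET y & c = cyc_lie_pair x y]].

End Lie.

(** A triple (vertex set, root, parent function) is a rooted tree when
    iterating the parent function leads from each vertex to the root; to make
    the encoding unique, the parent function fixes the root and every element
    of [I] that is not a vertex. *)
Definition is_rtree (I : finType) (c : {set I} * I * {ffun I -> I}) : bool :=
  let: (V, r, p) := c in
  [&& r \in V, p r == r,
      [forall v in V, (p v \in V) && fconnect p v r]
    & [forall v, (v \notin V) ==> (p v == v)]].

Record rtree (I : finType) := RTree {
  rtree_val : {set I} * I * {ffun I -> I};
  _ : is_rtree rtree_val
}.

HB.instance Definition _ (I : finType) := [isSub for @rtree_val I].
HB.instance Definition _ (I : finType) := [Finite of rtree I by <:].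

Section Trees.
Variable I : finType.
Implicit Types (S T U : rtree I) (v w : I).

Definition verts T : {set I} := (val T).1.1.
Definition root T : I := (val T).1.2.
Definition parent T : {ffun I -> I} := (val T).2.

Lemma disjointsU (A B C : {set I}) :
  [disjoint A :|: B & C] = [disjoint A & C] && [disjoint B & C].
Proof. by rewrite -!setI_eq0 finset.setIUl finset.setU_eq0. Qed.

Lemma rtree_eq S T :
  verts S = verts T -> root S = root T -> parent S =1 parent T -> S = T.
Proof.
move=> eV er /ffunP ep; apply: val_inj; move: eV er ep.
rewrite /verts /root /parent; case: (val S) => [[? ?] ?].
by case: (val T) => [[? ?] ?] /= -> -> ->.
Qed.

Lemma rtreeP T : [/\ root T \in verts T, parent T (root T) = root T,
  forall v, v \in verts T -> parent T v \in verts T,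
  forall v, v \in verts T -> exists n, iter n (parent T) v = root T
  & forall v, v \notin verts T -> parent T v = v].
Proof.
rewrite /root /verts /parent; case: T => [[[V r] p] /=].
case/and4P=> rV /eqP pr /forall_inP pV /forall_inP p0.
split=> // v vV.
- by case/andP: (pV v vV).
- case/andP: (pV v vV) => _ cvr; exists (findex p v r); exact: iter_findex.
- exact/eqP/p0.
Qed.

Lemma single_is_rtree (i : I) : is_rtree ([set i]%SET, i, [ffun v => v]).
Proof.
rewrite /is_rtree /= ffunE inE eqxx /=; apply/andP; split.
  by apply/forall_inP => v; rewrite inE => /eqP ->; rewrite ffunE inE eqxx connect0.
by apply/forall_inP => v _; rewrite ffunE.
Qed.

Definition single (i : I) : rtree I := RTree (single_is_rtree i).

Definition graft_val v S T : {set I} * I * {ffun I -> I} :=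
  (verts S :|: verts T, root S,
   [ffun x => if x \in verts T then (if x == root T then v else parent T x)
              else parent S x]).

Lemma graft_is_rtree v S T : [disjoint verts S & verts T] -> v \in verts S ->
  is_rtree (graft_val v S T).
Proof.
move=> dST vS; have [rS prS pS iS oS] := rtreeP S.
have [rT prT pT iT oT] := rtreeP T.
have nT x : x \in verts S -> (x \in verts T) = false.
  by move=> xS; apply: (disjointFr dST).
rewrite /is_rtree /graft_val; set p := [ffun x => _].
have pE x : x \in verts S -> p x = parent S x by move=> xS; rewrite ffunE nT.
have cS x : x \in verts S -> fconnect p x (root S).
  move=> xS; have [n] := iS x xS; elim: n x xS => [|n IH] x xS.
    by move=> /= ->; rewrite connect0.
  rewrite iterSr => /(IH _ (pS _ xS)); apply: connect_trans; apply: connect1.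
  by rewrite /= pE.
apply/and4P; split.
- by rewrite inE rS.
- by rewrite pE // prS.
- apply/forall_inP => x; rewrite inE; case/orP => xV.
    by rewrite pE // inE pS //= cS.
  apply/andP; split.
    by rewrite ffunE xV inE; case: eqP => _; rewrite ?vS ?pT ?orbT.
  have [n] := iT x xV; elim: n x xV => [|n IH] x xV.
    move=> /= xr; apply: (connect_trans _ (cS v vS)); apply: connect1.
    by rewrite /= ffunE xV xr eqxx.
  have [xr _|xr] := eqVneq x (root T).
    apply: (connect_trans _ (cS v vS)); apply: connect1.
    by rewrite /= ffunE xV xr eqxx.
  rewrite iterSr => /(IH _ (pT _ xV)); apply: connect_trans; apply: connect1.
  by rewrite /= ffunE xV (negbTE xr).
apply/forallP => x; apply/implyP; rewrite inE negb_or => /andP[xS xT].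
by rewrite ffunE (negbTE xT) oS.
Qed.

(** The tree obtained from the disjoint union of [S] and [T] by adding an edge
    from the root of [T] to the vertex [v] of [S]; irrelevant value when [S]
    and [T] are not disjoint or [v] is not a vertex of [S]. *)
Definition graft v S T : rtree I := insubd S (graft_val v S T).

Lemma val_graft v S T : [disjoint verts S & verts T] -> v \in verts S ->
  val (graft v S T) = graft_val v S T.
Proof. by move=> dST vS; rewrite /graft val_insubd graft_is_rtree. Qed.

Lemma verts_graft v S T : [disjoint verts S & verts T] -> v \in verts S ->
  verts (graft v S T) = verts S :|: verts T.
Proof. by move=> dST vS; rewrite [LHS]/verts val_graft. Qed.

Lemma root_graft v S T : [disjoint verts S & verts T] -> v \in verts S ->
  root (graft v S T) = root S.
Proof. by move=> dST vS; rewrite [LHS]/root val_graft. Qed.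

Lemma parent_graft v S T x : [disjoint verts S & verts T] -> v \in verts S ->
  parent (graft v S T) x =
    if x \in verts T then (if x == root T then v else parent T x)
    else parent S x.
Proof.
move=> dST vS; rewrite (_ : parent (graft v S T) = (val (graft v S T)).2) //.
by rewrite val_graft // ffunE. Qed.

Lemma graftA v w S T U :
  [disjoint verts S & verts T] -> [disjoint verts S & verts U] ->
  [disjoint verts T & verts U] -> v \in verts S -> w \in verts T ->
  graft w (graft v S T) U = graft v S (graft w T U).
Proof.
move=> dST dSU dTU vS wT.
have wST : w \in verts (graft v S T) by rewrite verts_graft // inE wT orbT.
have dSTU : [disjoint verts (graft v S T) & verts U].
  by rewrite verts_graft // disjointsU ?dSU ?dST.
have dS_TU : [disjoint verts S & verts (graft w T U)].
  by rewrite verts_graft // disjoint_sym disjointsU disjoint_sym dST disjoint_sym.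
have [rT _ _ _ _] := rtreeP T.
apply: rtree_eq => [||x].
- rewrite (verts_graft dSTU wST) (verts_graft dST vS) (verts_graft dS_TU vS).
  by rewrite (verts_graft dTU wT) finset.setUA.
- by rewrite (root_graft dSTU wST) (root_graft dST vS) (root_graft dS_TU vS).
rewrite (parent_graft x dSTU wST) (parent_graft x dST vS).
rewrite (parent_graft x dS_TU vS) (parent_graft x dTU wT).
rewrite (verts_graft dTU wT) (root_graft dTU wT) inE orbC.
case xU: (x \in verts U) => //=.
have xT : (x \in verts T) = false by apply: (disjointFl dTU).
by have [xr|//] := eqVneq x (root T); rewrite xr rT in xT.
Qed.

Lemma graftC v w S T U :
  [disjoint verts S & verts T] -> [disjoint verts S & verts U] ->
  [disjoint verts T & verts U] -> v \in verts S -> w \in verts S ->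
  graft w (graft v S T) U = graft v (graft w S U) T.
Proof.
move=> dST dSU dTU vS wS.
have wST : w \in verts (graft v S T) by rewrite verts_graft // inE wS.
have vSU : v \in verts (graft w S U) by rewrite verts_graft // inE vS.
have dSTU : [disjoint verts (graft v S T) & verts U].
  by rewrite verts_graft // disjointsU ?dSU ?dST.
have dSUT : [disjoint verts (graft w S U) & verts T].
  by rewrite verts_graft // disjointsU dST disjoint_sym.
apply: rtree_eq => [||x].
- rewrite (verts_graft dSTU wST) (verts_graft dST vS) (verts_graft dSUT vSU).
  by rewrite (verts_graft dSU wS) finset.setUAC.
- rewrite (root_graft dSTU wST) (root_graft dST vS) (root_graft dSUT vSU).
  by rewrite (root_graft dSU wS).
rewrite (parent_graft x dSTU wST) (parent_graft x dST vS).
rewrite (parent_graft x dSUT vSU) (parent_graft x dSU wS).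
by case xU: (x \in verts U) => //; rewrite (disjointFl dTU xU).
Qed.

(** The vector space spanned by the rooted trees with vertex set contained in
    [I]. *)
Definition trees := {freeg (rtree I) / rat}.

Definition graft_sum S T : trees :=
  if [disjoint verts S & verts T] then \sum_(v in verts S) << graft v S T >>
  else 0.

(** The pre-Lie product. It vanishes on trees with a common vertex, so that
    [trees] is the quotient of the free pre-Lie algebra on [I] by its
    components of degree at least 2 in some element of [I]. *)
Definition prelie : trees -> trees -> trees := fglift2 graft_sum.

HB.instance Definition _ := Bilinear.copy prelie (fglift2 graft_sum).

Lemma prelieE S T : prelie << S >> << T >> = graft_sum S T.
Proof. exact: fglift2_1. Qed.

Lemma prelie_graft_sum0 S T U :
  ~~ [&& [disjoint verts S & verts T], [disjoint verts S & verts U]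
       & [disjoint verts T & verts U]] ->
  prelie (graft_sum S T) << U >> = 0 /\ prelie << S >> (graft_sum T U) = 0.
Proof.
move=> nd; split.
  rewrite /graft_sum; case: ifP => [dST|_]; last by rewrite linear0l.
  rewrite linear_sumlz /= big1 // => v vS; rewrite prelieE /graft_sum.
  rewrite verts_graft // disjointsU; case: ifP => // /andP[dSU dTU].
  by rewrite dST dSU dTU in nd.
rewrite /graft_sum; case: ifP => [dTU|_]; last by rewrite linear0r.
rewrite linear_sumr /= big1 // => v vS; rewrite prelieE /graft_sum.
rewrite verts_graft // disjoint_sym disjointsU ![[disjoint _ & verts S]]disjoint_sym.
by case: ifP => // /andP[dST dSU]; rewrite dST dSU dTU in nd.
Qed.

Lemma prelie_id_trees S T U :
  prelie (graft_sum S T) << U >> - prelie << S >> (graft_sum T U)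
  = prelie (graft_sum S U) << T >> - prelie << S >> (graft_sum U T).
Proof.
have [/and3P[dST dSU dTU]|nd] := boolP [&& [disjoint verts S & verts T],
    [disjoint verts S & verts U] & [disjoint verts T & verts U]]; last first.
  have [-> ->] := prelie_graft_sum0 nd.
  rewrite andbCA (disjoint_sym (verts T) (verts U)) in nd.
  by have [-> ->] := prelie_graft_sum0 nd.
have half (T' U' : rtree I) : [disjoint verts S & verts T'] ->
    [disjoint verts S & verts U'] -> [disjoint verts T' & verts U'] ->
  prelie (graft_sum S T') << U' >> - prelie << S >> (graft_sum T' U')
  = \sum_(v in verts S) \sum_(w in verts S) << graft w (graft v S T') U' >>.
  move=> dST' dSU' dTU'; rewrite /graft_sum dST' dTU'.
  rewrite linear_sumlz linear_sumr /=.
  under eq_bigr => v vS.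
    rewrite prelieE /graft_sum (verts_graft dST' vS) disjointsU dSU' dTU' /=.
    rewrite (eq_bigl [predU verts S & verts T']); last by move=> w; rewrite !inE.
    rewrite bigU // /=; over.
  rewrite big_split /= -addrA -[RHS]addr0; congr (_ + _).
  apply/eqP; rewrite subr_eq0; apply/eqP; rewrite exchange_big /=.
  apply: eq_bigr => w wT; rewrite prelieE /graft_sum (verts_graft dTU' wT).
  rewrite disjoint_sym disjointsU disjoint_sym dST' disjoint_sym dSU' /=.
  by apply: eq_bigr => v vS; rewrite graftA.
rewrite !half //; last by rewrite disjoint_sym.
rewrite exchange_big /=; apply: eq_bigr => v vS; apply: eq_bigr => w wS.
by rewrite graftC.
Qed.

Lemma prelie_id x y z :
  prelie (prelie x y) z - prelie x (prelie y z)
  = prelie (prelie x z) y - prelie x (prelie z y).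
Proof.
pose D := fun x y z => prelie (prelie x y) z - prelie x (prelie y z).
have D1 y' z' : linear (fun x => D x y' z').
  move=> a u v; rewrite /D !linearPl /= opprD scalerBr.
  by rewrite addrACA.
have D2 x' z' : linear (fun y => D x' y z').
  move=> a u v; rewrite /D linearPr linearPl /= linearPl linearPr /=.
  by rewrite opprD scalerBr addrACA.
have D3 x' y' : linear (fun z => D x' y' z).
  move=> a u v; rewrite /D !linearPr /= opprD scalerBr.
  by rewrite addrACA.
rewrite -!/(D _ _ _); move: x; apply: freeg_linear_eq => // S.
move: y; apply: freeg_linear_eq => // T; move: z; apply: freeg_linear_eq => // U.
by rewrite /D !prelieE prelie_id_trees.
Qed.

End Trees.

Section PreLie.
Variable I : finType.

Definition PreLie (J : {set I}) : set (trees I) :=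
  lspan [set << T >> | T in [set T : rtree I | verts T = J]].

Definition root_valency (T : rtree I) : nat :=
  #|[set v in verts T | (v != root T) && (parent T v == root T)]%SET|.

Definition PreLie_v1 (J : {set I}) : set (trees I) :=
  lspan [set << T >> | T in
          [set T : rtree I | verts T = J /\ root_valency T = 1%N]].

Definition prelie_comm (x y : trees I) : trees I := prelie x y - prelie y x.

Lemma prelie_comm_is_bilinear : bilinear_for *:%R *:%R prelie_comm.
Proof.
by split=> z a x y; rewrite /prelie_comm linearPl linearPr /= opprD scalerBr addrACA.
Qed.

HB.instance Definition _ := bilinear_isBilinear.Build rat (trees I) (trees I)
  (trees I) *:%R *:%R prelie_comm prelie_comm_is_bilinear.

Lemma prelie_comm_jacobi x y z :
  prelie_comm x (prelie_comm y z) + prelie_comm y (prelie_comm z x)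
  + prelie_comm z (prelie_comm x y) = 0.
Proof.
rewrite /prelie_comm !(linearBl, linearBr) /=.
have := (prelie_id x y z, prelie_id y x z, prelie_id z x y).
case=> [[/eqP/freeg_eqP e1 /eqP/freeg_eqP e2] /eqP/freeg_eqP e3].
apply/eqP/freeg_eqP => T; move: (e1 T) (e2 T) (e3 T).
rewrite !(coeffD, coeffN, coeff0); lra.
Qed.

Fixpoint phi_bracketing (t : bracketing I) : trees I :=
  match t with
  | BLeaf i => << single i >>
  | BNode t u => prelie_comm (phi_bracketing t) (phi_bracketing u)
  end.

Definition phi_magma : magma I -> trees I := fglift phi_bracketing.

HB.instance Definition _ := GRing.Linear.copy phi_magma (fglift phi_bracketing).

Lemma phi_magma_mul x y :
  phi_magma (magma_mul x y) = prelie_comm (phi_magma x) (phi_magma y).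
Proof.
move: x; apply: freeg_linear_eq => [a u v|a u v|t].
- by rewrite linearPl linearP.
- by rewrite linearP linearPl.
move: y; apply: freeg_linear_eq => [a u v|a u v|u].
- by rewrite linearPr linearP.
- by rewrite linearP linearPr.
by rewrite /magma_mul fglift2_1 /phi_magma !fglift1.
Qed.

Lemma phi_subproof r : lie_rel r -> phi_magma r = 0.
Proof.
elim=> {r} [x y|x y z|x r _ IH|x r _ IH].
- by rewrite linearD /= !phi_magma_mul /prelie_comm addrC subrKA subrr.
- by rewrite !linearD /= !phi_magma_mul prelie_comm_jacobi.
- by rewrite phi_magma_mul IH linear0r.
- by rewrite phi_magma_mul IH linear0l.
Qed.

Definition phi : free_lie I -> trees I := llift phi_subproof.

HB.instance Definition _ := GRing.Linear.copy phi (llift phi_subproof).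

Lemma phi_class x : phi (lie_class x) = phi_magma x.
Proof. exact: lliftE. Qed.

Lemma phi_bracket x y : phi (lie_bracket x y) = prelie_comm (phi x) (phi y).
Proof.
rewrite -[x]lreprK -[y]lreprK -!/(lie_class _) lie_bracketE !phi_class.
exact: phi_magma_mul.
Qed.

(** As for [Lie]: the exterior square of [PreLie], evaluated at [I], is the
    subspace of [sq (-1) (trees I)] spanned by the products of an element of
    [PreLie J] and an element of [PreLie (~: J)]. The elements of [K_P] are the
    substitutions of elements of [PreLie], with [I] the disjoint union of their
    arities, in the two defining relations of CycPreLie; they span the
    sub-right-module [K_P(I)]. *)
Inductive K_P : set (sq (-1) (trees I)) :=
| K_P_anti A B C x y z of
    set_partition3 A B C & PreLie A x & PreLie B y & PreLie C z :
    K_P (sqmul (-1) x (prelie y z) + sqmul (-1) z (prelie y x))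
| K_P_inv A B C x y z of
    set_partition3 A B C & PreLie A x & PreLie B y & PreLie C z :
    K_P (sqmul (-1) x (prelie y z) - sqmul (-1) y (prelie x z - prelie z x)).

Definition cyc_prelie : Type := lquot K_P.

HB.instance Definition _ := GRing.Lmodule.on cyc_prelie.

(** The class [<x, y>] of the exterior product of [x] and [y]. *)
Definition cyc_prelie_pair (x y : trees I) : cyc_prelie :=
  lclass K_P (sqmul (-1) x y).

Definition CycPreLie : set cyc_prelie :=
  lspan [set c | exists J x y,
           [/\ PreLie J x, PreLie (~: J)%SET y & c = cyc_prelie_pair x y]].

Lemma cyc_prelie_pair_is_bilinear : bilinear_for *:%R *:%R cyc_prelie_pair.
Proof.
split=> z a x y; rewrite /cyc_prelie_pair; first by rewrite linearPl linearP.
by rewrite linearPr linearP.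
Qed.

HB.instance Definition _ := bilinear_isBilinear.Build rat (trees I) (trees I)
  cyc_prelie *:%R *:%R cyc_prelie_pair cyc_prelie_pair_is_bilinear.

Lemma cyc_prelie_pairC x y : cyc_prelie_pair x y = - cyc_prelie_pair y x.
Proof. by rewrite /cyc_prelie_pair sqmulC linearZ /= scaleN1r. Qed.

(** The Hadamard product of [Perm] and [CycPreLie], evaluated at [I], is
    encoded by functions from [I]: [f] stands for the sum over [a] of
    [a (x) f a]. *)
Definition perm_cyc_prelie := {ffun I -> cyc_prelie}.

(** The element [(a - b) (x) t]. *)
Definition perm_diff (a b : I) (t : cyc_prelie) : perm_cyc_prelie :=
  [ffun i => ((i == a)%:R - (i == b)%:R) *: t].

(** The value of [theta] on the product of two trees, and its bilinear extension
    to linear combinations of trees. *)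
Definition theta_trees (S T : rtree I) : perm_cyc_prelie :=
  perm_diff (root S) (root T) (cyc_prelie_pair << S >> << T >>).

Definition theta_bilin : trees I -> trees I -> perm_cyc_prelie :=
  fglift2 theta_trees.

HB.instance Definition _ := Bilinear.copy theta_bilin (fglift2 theta_trees).

Lemma theta_bilinC x y : theta_bilin x y = 1 *: theta_bilin y x.
Proof.
rewrite scale1r; move: x; apply: freeg_linear_eq => [a u v|a u v|S].
- exact: (linearPl theta_bilin).
- exact: (linearPr theta_bilin).
move: y; apply: freeg_linear_eq => [a u v|a u v|T].
- exact: (linearPr theta_bilin).
- exact: (linearPl theta_bilin).
rewrite /theta_bilin !fglift2_1; apply/ffunP => i; rewrite !ffunE.
by rewrite cyc_prelie_pairC scalerN -scaleNr opprB.
Qed.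

Definition theta_sq : sq 1 (trees I) -> perm_cyc_prelie := sqlift theta_bilinC.

HB.instance Definition _ := GRing.Linear.copy theta_sq (sqlift theta_bilinC).

Definition theta_sq_lie (l : sq 1 (free_lie I)) : perm_cyc_prelie :=
  theta_sq (sqmap phi l).

Lemma theta_sq_lie_is_linear : linear theta_sq_lie.
Proof. by move=> a x y; rewrite /theta_sq_lie !linearP. Qed.

HB.instance Definition _ := GRing.isLinear.Build rat (sq 1 (free_lie I))
  perm_cyc_prelie _ theta_sq_lie theta_sq_lie_is_linear.

Lemma theta_sq_lieE x y : theta_sq_lie (sqmul 1 x y) = theta_bilin (phi x) (phi y).
Proof. by rewrite /theta_sq_lie sqmapE; exact: sqliftE. Qed.


Lemma PreLie_lin (J : {set I}) (f : trees I -> trees I) (L : {set I}) :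
  linear f -> (forall T, verts T = J -> PreLie L (f << T >>)) ->
  forall x, PreLie J x -> PreLie L (f x).
Proof.
move=> fL fT; apply: (lspan_lin fL) => [|a u v lu lv|_ [T TJ <-]].
- exact: lspan_0.
- by apply: lspanD => //; apply: lspanZ.
- exact: fT.
Qed.

Lemma PreLie_prelie A B x y :
  PreLie A x -> PreLie B y -> PreLie (A :|: B) (prelie x y).
Proof.
move=> Ax; move: y; apply: PreLie_lin => [|T TB].
  by move=> a u v; rewrite linearPr.
move: x Ax; apply: (PreLie_lin (f := (@prelie I)^~ _)) => [|S SA].
  by move=> a u v; rewrite linearPl.
rewrite prelieE /graft_sum; case: ifP => [dST|_]; last exact: lspan_0.
apply: lspan_sum => v vS; apply: lspan_gen; exists (graft v S T) => //=.
by rewrite verts_graft // SA TB.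
Qed.

Lemma PreLie_comm A B x y :
  PreLie A x -> PreLie B y -> PreLie (A :|: B) (prelie_comm x y).
Proof.
move=> Ax By; rewrite /prelie_comm -scaleN1r; apply: lspanD.
  exact: PreLie_prelie.
by apply: lspanZ; rewrite finset.setUC; apply: PreLie_prelie.
Qed.

Lemma phi_PreLie A x : Lie A x -> PreLie A (phi x).
Proof.
move: x; apply: (lspan_lin (linearP phi)) => [|a u v lu lv|_ [t tA <-]].
- exact: lspan_0.
- by apply: lspanD => //; apply: lspanZ.
rewrite /= phi_class /phi_magma fglift1; case/andP: tA => _ /eqP <-.
elim: t => [i|t IHt u IHu] /=.
  apply: lspan_gen; exists (single i) => //=.
  by apply/setP => j; rewrite !inE.
have -> : ([set i in leaves t ++ leaves u] =
    [set i in leaves t] :|: [set i in leaves u])%SET.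
  by apply/setP => j; rewrite !inE mem_cat.
exact: PreLie_comm.
Qed.

Lemma perm_diff_is_linear (a b : I) : linear (perm_diff a b).
Proof.
by move=> c s t; apply/ffunP => i; rewrite !ffunE scalerDr !scalerA mulrC.
Qed.

Lemma theta_graftl (S T U : rtree I) :
  theta_bilin (prelie << S >> << T >>) << U >>
  = perm_diff (root S) (root U)
      (cyc_prelie_pair (prelie << S >> << T >>) << U >>).
Proof.
rewrite prelieE /graft_sum; case: ifP => [dST|_]; last first.
  by rewrite !linear0l; apply/ffunP => i; rewrite !ffunE scaler0.
rewrite !linear_sumlz /=; apply/ffunP => i; rewrite sum_ffunE ffunE scaler_sumr.
apply: eq_bigr => v vS; rewrite /theta_bilin fglift2_1 /theta_trees.
by rewrite ffunE root_graft.
Qed.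

Lemma theta_graftr (S T U : rtree I) :
  theta_bilin << U >> (prelie << S >> << T >>)
  = perm_diff (root U) (root S)
      (cyc_prelie_pair << U >> (prelie << S >> << T >>)).
Proof.
rewrite theta_bilinC scale1r theta_graftl; apply/ffunP => i; rewrite !ffunE.
by rewrite cyc_prelie_pairC scalerN -scaleNr opprB.
Qed.

Lemma theta_inv A B C x y z : set_partition3 A B C ->
  PreLie A x -> PreLie B y -> PreLie C z ->
  theta_bilin (prelie_comm x y) z = theta_bilin x (prelie_comm y z).
Proof.
move=> ABC Ax By Cz.
pose D x y z := theta_bilin (prelie_comm x y) z
                - theta_bilin x (prelie_comm y z).
suff : D x y z = 0 by move=> /eqP; rewrite subr_eq0 => /eqP.
have D0 a (u v : perm_cyc_prelie) : u = 0 -> v = 0 -> a *: u + v = 0.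
  by move=> -> ->; rewrite scaler0 addr0.
have D1 y' z' : linear (fun x => D x y' z').
  by move=> a u v; rewrite /D !linearPl /= opprD scalerBr addrACA.
have D2 x' z' : linear (fun y => D x' y z').
  move=> a u v; rewrite /D linearPr linearPl /= linearPl linearPr /=.
  by rewrite opprD scalerBr addrACA.
have D3 x' y' : linear (fun z => D x' y' z).
  by move=> a u v; rewrite /D !linearPr /= opprD scalerBr addrACA.
move: x Ax; apply: (lspan_lin (H := [set 0]) (D1 y z) _ D0) => //= _ [S SA <-].
move: y By; apply: (lspan_lin (H := [set 0]) (D2 _ z) _ D0) => //= _ [T TB <-].
move: z Cz; apply: (lspan_lin (H := [set 0]) (D3 _ _) _ D0) => //= _ [U UC <-].
have gen (J : {set I}) (W : rtree I) : verts W = J -> PreLie J << W >>.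
  by move=> WJ; apply: lspan_gen; exists W.
have [[Sx Ty] Uz] := (gen _ _ SA, gen _ _ TB, gen _ _ UC).
have [uABC dAB dAC dBC] := ABC.
have ACB : set_partition3 A C B by split; rewrite // 1?disjoint_sym // finset.setUAC.
have BAC : set_partition3 B A C.
  by split; rewrite // 1?disjoint_sym // (finset.setUC B).
have anti J K L x y z : set_partition3 J K L ->
    PreLie J x -> PreLie K y -> PreLie L z ->
    cyc_prelie_pair x (prelie y z) = - cyc_prelie_pair z (prelie y x).
  move=> JKL Jx Ky Lz; apply/eqP; rewrite -addr_eq0; apply/eqP.
  have /lclass_gen := K_P_anti JKL Jx Ky Lz.
  by rewrite linearD.
have eX := anti _ _ _ _ _ _ ABC Sx Ty Uz.
have eY := anti _ _ _ _ _ _ BAC Ty Sx Uz.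
have eZ := anti _ _ _ _ _ _ ACB Sx Uz Ty.
have eI : cyc_prelie_pair << S >> (prelie << T >> << U >>)
    = cyc_prelie_pair << T >> (prelie << S >> << U >>)
      + cyc_prelie_pair << S >> (prelie << U >> << T >>).
  rewrite eZ -linearBr; apply/eqP; rewrite -subr_eq0; apply/eqP.
  have /lclass_gen := K_P_inv ABC Sx Ty Uz.
  by rewrite linearB.
rewrite /D /prelie_comm linearBl linearBr /= !theta_graftl !theta_graftr.
rewrite ![cyc_prelie_pair _ << U >>]cyc_prelie_pairC -eX -eY eI.
apply/ffunP => i; rewrite !ffunE; move: (cyc_prelie_pair _ _) => Y.
move: (cyc_prelie_pair _ _) => Z.
move: (_ == root S)%:R (_ == root T)%:R (_ == root U)%:R => s t u.

rewrite opprB addrACA -scalerDr -opprD -scalerDl [t - u + _]addrC addrA.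
by rewrite subrK subrr.
Qed.

Lemma theta_subproof l : K_L l -> theta_sq_lie l = 0.
Proof.
case=> A B C x y z ABC Ax By Cz; rewrite linearB /= !theta_sq_lieE.
rewrite !phi_bracket (theta_inv ABC) ?subrr //; exact: phi_PreLie.
Qed.

Definition theta : cyc_lie I -> perm_cyc_prelie := llift theta_subproof.

HB.instance Definition _ := GRing.Linear.copy theta (llift theta_subproof).

Lemma thetaE x y : theta (cyc_lie_pair x y) = theta_bilin (phi x) (phi y).
Proof. by rewrite /theta lliftE /= theta_sq_lieE. Qed.

Lemma theta_CycPreLie l a : CycLie l -> CycPreLie (theta l a).
Proof.
move: l; apply: (lspan_lin (f := fun l => theta l a)) => [b u v||b u v lu lv|].
- by rewrite linearP !ffunE.
- exact: lspan_0.
- by apply: lspanD => //; apply: lspanZ.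
move=> _ [J [x [y [/phi_PreLie Jx /phi_PreLie Jy ->]]]]; rewrite thetaE.
move: (phi x) Jx; apply: (lspan_lin (f := fun x => theta_bilin x _ a)).
- by move=> b u v; rewrite linearPl !ffunE.
- exact: lspan_0.
- by move=> b u v lu lv; apply: lspanD => //; apply: lspanZ.
move=> _ [S SJ <-]; move: (phi y) Jy.
apply: (lspan_lin (f := fun y => theta_bilin _ y a)).
- by move=> b u v; rewrite linearPr !ffunE.
- exact: lspan_0.
- by move=> b u v lu lv; apply: lspanD => //; apply: lspanZ.
move=> _ [T TJ <-]; rewrite /theta_bilin fglift2_1 ffunE; apply: lspanZ.
apply: lspan_gen; exists J, << S >>, << T >>; split=> //.
  by apply: lspan_gen; exists S.
by apply: lspan_gen; exists T.
Qed.

(** For [t] in [CycPreLie], the unique [s] in [PreLie (~: [set i])] such that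
    [t = <i, s>]. *)
Definition Gamma (i : I) (t : cyc_prelie) : trees I :=
  xget 0 [set s | PreLie (~: [set i])%SET s
                  /\ t = cyc_prelie_pair << single i >> s].

(** [psi (a (x) t) = prelie a (Gamma a t)] *)
Definition psi (f : perm_cyc_prelie) : trees I :=
  \sum_(a : I) prelie << single a >> (Gamma a (f a)).

Definition lambda (l : cyc_lie I) : trees I := psi (theta l).

End PreLie.

(* Main.v *)
Require Import Defs.
From HB Require Import structures.
From mathcomp Require Import all_boot all_order all_algebra.
From mathcomp Require Import boolp classical_sets freeg zify ring.

(** Write [l] in CycLie as [(i, x)] with [x] in Lie. The trees with root [i] in
    [lambda l] form [i <| Gamma_i (theta l)_i], and [(theta l)_i = <i, phi x>],
    so everything reduces to: [<i, phi x> = 0] implies [x = 0].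

    This needs linear forms on CycPreLie. The two relations of CycPreLie are the
    identities satisfied by a symplectic form on a Lie algebra and the pre-Lie
    product it induces. Take the cotangent extension [R (+) R^*] of a matrix
    algebra [R] with its canonical symplectic form, send [i] to [R^*] and the
    other generators to [R]: [<i, phi x>] is mapped to the trace of [x(R)]
    against an arbitrary matrix. Elementary matrices then read off the
    coordinates of [x] in the basis of left-normed brackets starting with a
    fixed letter.

    Evaluating trees in an arbitrary pre-Lie algebra amounts to the existence
    part of the freeness of the pre-Lie algebra of rooted trees. *)

Set Implicit Arguments.
Unset Strict Implicit.
Unset Printing Implicit Defensive.

(* [Defs] comes last because [root] is also the root predicate of polynomials. *)
Import GRing.Theory Defs.
Local Open Scope ring_scope.

(** * Branches at the root *)

Section RootedTrees.
Variable I : finType.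
Implicit Types (S T U W : rtree I) (v w x : I).

Lemma verts_gt0 T : (0 < #|verts T|)%N.
Proof. by have [rT _ _ _ _] := rtreeP T; apply/card_gt0P; exists (root T). Qed.

Lemma card_verts_graft v S T : [disjoint verts S & verts T] -> v \in verts S ->
  #|verts (graft v S T)| = (#|verts S| + #|verts T|)%N.
Proof.
by move=> dST vS; rewrite verts_graft // cardsU disjoint_setI0 // cards0 subn0.
Qed.

Lemma root_valency_single (i : I) : root_valency (single i) = 0%N.
Proof.
apply/eqP; rewrite cards_eq0; apply/eqP/setP => v.
by rewrite !inE; case: (v == i).
Qed.

Lemma root_valency_le T : (root_valency T <= #|I|)%N.
Proof. exact: max_card. Qed.

Lemma root_valency_graft v S T : [disjoint verts S & verts T] ->
  v \in verts S ->
  root_valency (graft v S T) = ((v == root S) + root_valency S)%N.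
Proof.
move=> dST vS; rewrite /root_valency.
have [rT prT pT iT oT] := rtreeP T; have [rS prS pS iS oS] := rtreeP S.
have rTS : root T \notin verts S by rewrite (disjointFl dST).
have rTr : root T != root S by apply: contraNneq rTS => ->.
set C := [set x in verts S | _]%SET.
have nC : root T \notin C by rewrite inE (negbTE rTS).
have E x : (x \in verts S :|: verts T)%SET &&
   ((x != root S) && (parent (graft v S T) x == root S)) =
   ((v == root S) && (x == root T)) || (x \in C).
  rewrite parent_graft // !inE.
  have [xT|xT] /= := boolP (x \in verts T).
    have xS : (x \in verts S) = false by rewrite (disjointFl dST).
    have -> : x != root S by apply: contraFneq xS => ->.
    rewrite xS orbT orbF /=; have [_|nx] := eqVneq x (root T).
      by rewrite andbT.
    rewrite andbF; apply: contraTF (pT _ xT) => /eqP ->.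
    by rewrite (disjointFr dST).
  by case: (eqVneq x (root T)) xT => [->|_ _]; rewrite ?rT // andbF orbF.
have [vr|vr] := eqVneq v (root S).
  transitivity #|(root T |: C)%SET|; last by rewrite cardsU1 nC.
  by apply: eq_card => x; rewrite inE verts_graft // root_graft // E vr eqxx !inE.
apply: eq_card => x; rewrite inE verts_graft // root_graft // E.
by rewrite (negbTE vr).
Qed.

(** A path to the root that starts in [V] stays in [V]. This builds the common part of two trees in
    [root_graft_exchange]. *)
Lemma induced_is_rtree S (V : {set I}) :
  V \subset verts S -> root S \in V ->
  (forall v, v \in V -> parent S v \in V) ->
  is_rtree (V, root S, [ffun v => if v \in V then parent S v else v]).
Proof.
move=> VS rV pV; have [rS prS pS iS oS] := rtreeP S.
rewrite /is_rtree; set p := [ffun v => _].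
have pE v : v \in V -> p v = parent S v by move=> vV; rewrite ffunE vV.
apply/and4P; split=> //.
- by rewrite pE // prS.
- apply/forall_inP => v vV; rewrite pE // pV //=.
  have [n] := iS v (fintype.subsetP VS _ vV); elim: n v vV => [|n IH] v vV.
    by move=> /= ->; apply: connect0.
  rewrite iterSr => /(IH _ (pV _ vV)); apply: connect_trans; apply: connect1.
  by rewrite /= pE.
- by apply/forallP => v; apply/implyP => vV; rewrite ffunE (negbTE vV).
Qed.

(** * Two ways of cutting a branch off the root of one tree *)

Section RootGrafts.
Variables S T S1 T1 : rtree I.
Hypotheses (dST : [disjoint verts S & verts T])
  (dST1 : [disjoint verts S1 & verts T1])
  (eW : graft (root S) S T = graft (root S1) S1 T1).

Let rS : root S \in verts S. Proof. by case: (rtreeP S). Qed.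
Let rS1 : root S1 \in verts S1. Proof. by case: (rtreeP S1). Qed.

Lemma root_graft_root : root S = root S1.
Proof. by have := congr1 (@root I) eW; rewrite !root_graft. Qed.

Lemma root_graft_verts : (verts S :|: verts T = verts S1 :|: verts T1)%SET.
Proof. by have := congr1 (@verts I) eW; rewrite !verts_graft. Qed.

Lemma root_graft_parent x :
  (if x \in verts T then (if x == root T then root S else parent T x)
   else parent S x) =
  (if x \in verts T1 then (if x == root T1 then root S1 else parent T1 x)
   else parent S1 x).
Proof. by rewrite -!parent_graft // eW. Qed.

(** Induction on the distance to the root of [T]. If [v] lay in [S1] and its parent in [T1], then
    that parent would also lie in [S1], against disjointness. *)
Lemma root_graft_sub : root T = root T1 -> verts T \subset verts T1.
Proof.
move=> eT; have [rT prT pT iT oT] := rtreeP T.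
have [rT1 prT1 pT1 iT1 oT1] := rtreeP T1; have [_ _ pS1 _ _] := rtreeP S1.
apply/fintype.subsetP => v vT.
have [n] := iT v vT; elim: n v vT => [|n IH] v vT; first by move=> /= ->; rewrite eT.
rewrite iterSr => /(IH _ (pT _ vT)) => pvT1.
apply: contraT => vT1; have /setP /(_ v) := root_graft_verts.
rewrite !inE vT orbT (negbTE vT1) orbF => /esym vS1.
have := root_graft_parent v; rewrite vT (negbTE vT1).
case: eqVneq => [vr|_ e]; first by rewrite vr eT rT1 in vT1.
by move: (pS1 v vS1); rewrite -e (disjointFl dST1 pvT1).
Qed.

(** Both roots are children of the common root, so neither lies in the other branch. The parent of a
    common vertex is then again common, and climbing to the root of [T] is contradictory. *)
Lemma root_graft_disjoint : root T != root T1 -> [disjoint verts T & verts T1].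
Proof.
move=> nT; have [rT prT pT iT oT] := rtreeP T.
have [rT1 prT1 pT1 iT1 oT1] := rtreeP T1.
have c1 : root T \notin verts T1.
  apply/negP => cT1; have := root_graft_parent (root T).
  rewrite rT eqxx cT1 (negbTE nT) => e; have := pT1 _ cT1.
  by rewrite -e root_graft_root (disjointFr dST1).
have c2 : root T1 \notin verts T.
  apply/negP => cT; have := root_graft_parent (root T1).
  rewrite rT1 eqxx cT eq_sym (negbTE nT) => e; have := pT _ cT.
  by rewrite e -root_graft_root (disjointFr dST).
rewrite -setI_eq0; apply/eqP/setP => v; rewrite !inE; apply/negP => /andP[vT].
have [n] := iT v vT; elim: n v vT => [|n IH] v vT.
  by move=> /= ->; apply/negP.
rewrite iterSr => e vT1; apply: (IH _ (pT _ vT)) => //.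
have := root_graft_parent v; rewrite vT vT1.
case: eqVneq vT1 => [->|_ vT1]; first by rewrite (negbTE c1).
case: eqVneq vT => [->|_ vT ->]; first by rewrite (negbTE c2).
exact: pT1.
Qed.

(** Being disjoint from [T], [T1] is a branch of [S] at the root, and the rest of [S] is its
    intersection with [S1]. Any [S'] with these data is allowed, so that the two graftings can be
    exchanged. *)
Lemma root_graft_common S' : root T != root T1 ->
  verts S' = (verts S :&: verts S1)%SET -> root S' = root S ->
  (forall x, x \in verts S' -> parent S' x = parent S x) ->
  [disjoint verts S' & verts T1] /\ S = graft (root S') S' T1.
Proof.
move=> nT vS' rS' pS'; have dTT1 := root_graft_disjoint nT.
have [r' _ _ _ oS'] := rtreeP S'; have [_ _ _ _ oS] := rtreeP S.
have dS'T1 : [disjoint verts S' & verts T1].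
  by apply: disjointWl dST1; rewrite vS' finset.subsetIr.
split=> //; apply: rtree_eq; rewrite ?verts_graft ?root_graft //.
  apply/setP => x; move/setP/(_ x): root_graft_verts; rewrite vS' !inE.
  have [xT1 |xT1] := boolP (x \in verts T1).
    by rewrite (disjointFl dTT1 xT1) !orbT orbF.
  rewrite !orbF; case xS: (x \in verts S) => //=.
move=> x; rewrite parent_graft //; have := root_graft_parent x.
have [xT1 |xT1] := boolP (x \in verts T1).
  by rewrite (disjointFl dTT1 xT1) rS' root_graft_root.
have [xS'|xS' _] := boolP (x \in verts S'); first by rewrite pS'.
rewrite oS' // oS //; apply: contra xS' => xS; rewrite vS' inE xS.
by move/setP/(_ x): root_graft_verts; rewrite !inE xS (negbTE xT1) orbF.
Qed.

End RootGrafts.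

(** [root_graft_sub] in both directions equates the vertex sets; the parents are then read off the
    grafted tree. *)
Lemma root_graft_inj S T S1 T1 :
  [disjoint verts S & verts T] -> [disjoint verts S1 & verts T1] ->
  graft (root S) S T = graft (root S1) S1 T1 -> root T = root T1 ->
  S = S1 /\ T = T1.
Proof.
move=> dST dST1 eW eT.
have vT : verts T = verts T1.
  apply/eqP; rewrite finset.eqEsubset.
  rewrite (root_graft_sub dST dST1 eW eT).
  by rewrite (root_graft_sub dST1 dST (esym eW) (esym eT)).
have vS : verts S = verts S1.
  apply/setP => x; move/setP/(_ x): (root_graft_verts dST dST1 eW).
  rewrite !inE -vT; case xT: (x \in verts T); last by rewrite !orbF.
  by rewrite (disjointFl dST xT) (disjointFl dST1) // -vT.
have pE := root_graft_parent dST dST1 eW.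
have [rT prT _ _ oT] := rtreeP T; have [_ prT1 _ _ oT1] := rtreeP T1.
have [_ _ _ _ oS] := rtreeP S; have [_ _ _ _ oS1] := rtreeP S1.
split; apply: rtree_eq => //.
- exact: (root_graft_root dST dST1 eW).
- move=> x; move: (pE x); rewrite -vT; case: ifP => // xT _.
  by rewrite oS ?oS1 // -?vS (disjointFl dST xT).
- move=> x; move: (pE x); rewrite -vT -eT; case: ifP => [_|/negbT xT _].
    by case: eqP => // -> _; rewrite [in RHS]eT prT prT1.
  by rewrite oT ?oT1 // -vT.
Qed.

(** [S'] is the tree with both branches removed, induced on the vertices common to [S] and [S1]. *)
Lemma root_graft_exchange S T S1 T1 :
  [disjoint verts S & verts T] -> [disjoint verts S1 & verts T1] ->
  graft (root S) S T = graft (root S1) S1 T1 -> root T != root T1 ->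
  exists S', [/\ [disjoint verts S' & verts T], [disjoint verts S' & verts T1],
    [disjoint verts T & verts T1], S = graft (root S') S' T1
    & S1 = graft (root S') S' T].
Proof.
move=> dST dST1 eW nT; have nT1 : root T1 != root T by rewrite eq_sym.
pose V := (verts S :&: verts S1)%SET.
have rE := root_graft_root dST dST1 eW.
have [rS _ pS _ _] := rtreeP S; have [rS1 _ pS1 _ _] := rtreeP S1.
have pE x : x \in V -> parent S x = parent S1 x.
  rewrite inE => /andP[xS xS1]; have := root_graft_parent dST dST1 eW x.
  by rewrite (disjointFr dST xS) (disjointFr dST1 xS1).
have Vtree : is_rtree (V, root S, [ffun v => if v \in V then parent S v else v]).
  apply: induced_is_rtree; first exact: finset.subsetIl.
    by rewrite inE rS rE rS1.
  by move=> v vV; rewrite inE {2}(pE v vV); move: vV; rewrite inE => /andP[/pS -> /pS1].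
pose S' := RTree Vtree.
have pS' x : x \in verts S' -> parent S' x = parent S x.
  by move=> xV; rewrite /S' [LHS]ffunE [_ \in V]xV.
have [dS'T1 eS] := root_graft_common dST dST1 eW nT (erefl (verts S')) (erefl _) pS'.
have [||dS'T eS1] := root_graft_common (S' := S') dST1 dST (esym eW) nT1 _ rE.
- exact: finset.setIC.
- by move=> x xS'; rewrite pS' // pE.
by exists S'; split=> //; exact: root_graft_disjoint eW nT.
Qed.

End RootedTrees.

(** * Evaluation of trees in a pre-Lie algebra *)

Section Evaluation.
Variables (I : finType) (A : lmodType rat) (m : {bilinear A -> A -> A}).
Hypothesis mP : forall x y z, m (m x y) z - m x (m y z) = m (m x z) y - m x (m z y).
Variable x : I -> A.
Implicit Types (S T U W : rtree I) (v : I).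

(** The branch to cut is chosen arbitrarily; [eval_prelie_trees] shows that every other choice
    satisfies the same formula. *)
Definition root_split W : option (rtree I * rtree I) :=
  [pick ST | [disjoint verts ST.1 & verts ST.2]
             && (W == graft (root ST.1) ST.1 ST.2)].

Lemma root_split_Some W S T : root_split W = Some (S, T) ->
  [disjoint verts S & verts T] /\ W = graft (root S) S T.
Proof.
rewrite /root_split; case: pickP => // p pP [e].
by move: pP; rewrite e => /andP[? /eqP].
Qed.

Lemma root_split_graft S T : [disjoint verts S & verts T] ->
  root_split (graft (root S) S T) != None.
Proof.
by move=> dST; rewrite /root_split; case: pickP => // /(_ (S, T)); rewrite dST eqxx.
Qed.

Lemma root_split_single i : root_split (single i) = None.
Proof.
case E: (root_split _) => [[S T]|//]; have [dST eW] := root_split_Some E.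
have rS : root S \in verts S by case: (rtreeP S).
have := congr1 (fun W => #|verts W|) eW; rewrite card_verts_graft // cards1.
by have := verts_gt0 S; have := verts_gt0 T; lia.
Qed.

(** [graft (root S) S T] is [S <| T] minus the sum of the [graft v S T] for
    [v != root S], which have as many vertices but a smaller root valency: the
    recursion is lexicographic. *)
Definition weight W : nat := (#|verts W| * #|I|.+1 + root_valency W)%N.

(** [n] bounds the recursion depth; the default 0 is not reached when [n] exceeds the weight. *)
Fixpoint tree_eval_rec n W : A :=
  if n isn't n'.+1 then 0 else
  if root_split W is Some (V, T) then
    m (tree_eval_rec n' V) (tree_eval_rec n' T)
    - \sum_(v in verts V | v != root V) tree_eval_rec n' (graft v V T)
  else x (root W).

Definition tree_eval W := tree_eval_rec (weight W).+1 W.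

(** A valency is at most [#|I|], so one vertex, counted [#|I|.+1], outweighs it. *)
Lemma weight_lt S T :
  (#|verts S| < #|verts T|)%N -> (weight S < weight T)%N.
Proof.
move=> lt; have := root_valency_le S; rewrite /weight => le.
by rewrite (@leq_trans (#|verts S|.+1 * #|I|.+1)) ?mulSn //; [lia|nia].
Qed.

Lemma tree_eval_rec_weight n n' W : (weight W < n)%N -> (weight W < n')%N ->
  tree_eval_rec n W = tree_eval_rec n' W.
Proof.
elim: n n' W => [|n IH] [|n'] W //= ltn ltn'.
case E: (root_split W) => [[S T]|//]; have [dST eW] := root_split_Some E.
have rS : root S \in verts S by case: (rtreeP S).
have [S0 T0] := (verts_gt0 S, verts_gt0 T).
have cW : #|verts W| = (#|verts S| + #|verts T|)%N.
  by rewrite eW card_verts_graft.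
have ltS : (weight S < weight W)%N by apply: weight_lt; lia.
have ltT : (weight T < weight W)%N by apply: weight_lt; lia.
rewrite (IH n' S) ?(IH n' T); try lia.
congr (_ - _); apply: eq_bigr => v /andP[vS vr]; apply: IH.
  move: ltn; rewrite /weight eW !card_verts_graft // !root_valency_graft //.
  by rewrite eqxx (negbTE vr); lia.
move: ltn'; rewrite /weight eW !card_verts_graft // !root_valency_graft //.
by rewrite eqxx (negbTE vr); lia.
Qed.

Lemma tree_evalE W n : (weight W < n)%N -> tree_eval_rec n W = tree_eval W.
Proof. by move=> lt; apply: tree_eval_rec_weight. Qed.

Lemma tree_eval_single i : tree_eval (single i) = x i.
Proof. by rewrite /tree_eval /= root_split_single. Qed.

Lemma tree_eval_split W S T : root_split W = Some (S, T) ->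
  tree_eval W = m (tree_eval S) (tree_eval T)
    - \sum_(v in verts S | v != root S) tree_eval (graft v S T).
Proof.
move=> E; have [dST eW] := root_split_Some E.
have rS : root S \in verts S by case: (rtreeP S).
have [S0 T0] := (verts_gt0 S, verts_gt0 T).
have cW : #|verts W| = (#|verts S| + #|verts T|)%N.
  by rewrite eW card_verts_graft.
rewrite [in LHS]/tree_eval /= E !tree_evalE; try by apply: weight_lt; lia.
congr (_ - _); apply: eq_bigr => v /andP[vS vr]; apply: tree_evalE.
rewrite /weight eW !card_verts_graft // !root_valency_graft //.
by rewrite eqxx (negbTE vr); lia.
Qed.

Definition eval : trees I -> A := fglift tree_eval.

HB.instance Definition _ := GRing.Linear.copy eval (fglift tree_eval).

Lemma eval_tree T : eval << T >> = tree_eval T.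
Proof. exact: fglift1. Qed.

Let offroot S T : trees I := \sum_(v in verts S | v != root S) << graft v S T >>.

Lemma prelie_root_graft S T : [disjoint verts S & verts T] ->
  prelie << S >> << T >> = << graft (root S) S T >> + offroot S T.
Proof.
move=> dST; have rS : root S \in verts S by case: (rtreeP S).
by rewrite prelieE /graft_sum dST (bigD1 (root S)).
Qed.

Lemma eval_split W S T : root_split W = Some (S, T) ->
  eval (prelie << S >> << T >>) = m (eval << S >>) (eval << T >>).
Proof.
move=> E; have [dST eW] := root_split_Some E.
rewrite prelie_root_graft // -eW linearD /= !eval_tree (tree_eval_split E).
rewrite [eval (offroot _ _)]linear_sum /=.
by rewrite (eq_bigr _ (fun v _ => eval_tree _)) subrK.
Qed.

(** If [root_split] cuts off [T], this is the recursive definition. Otherwise it cuts off a branch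
    [U], and the tree is some [S'] with [T] and [U] both grafted at the root; the pre-Lie identity,
    on trees and in [A], exchanges the two graftings. *)
Lemma eval_prelie_trees S T : [disjoint verts S & verts T] ->
  eval (prelie << S >> << T >>) = m (eval << S >>) (eval << T >>).
Proof.
(* Lexicographic measure: total number of vertices, then root valency of the left factor. *)
pose w S T := ((#|verts S| + #|verts T|) * #|I|.+1 + root_valency S)%N.
have [n] := ubnP (w S T); elim: n S T => // n IH S T; rewrite ltnS => leST dST.
have rS : root S \in verts S by case: (rtreeP S).
case E: (root_split (graft (root S) S T)) (root_split_graft dST) => [[S1 U]|//] _.
have [dS1U eW] := root_split_Some E.
have [eTU|nTU] := eqVneq (root T) (root U).
  have [eS eT] := root_graft_inj dST dS1U eW eTU.
  by rewrite -eS -eT in E; exact: eval_split E.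
have [S' [dS'T dS'U dTU eS eS1]] := root_graft_exchange dST dS1U eW nTU.
have rS' : root S' \in verts S' by case: (rtreeP S').
have T0 := verts_gt0 T; have U0 := verts_gt0 U; have S'0 := verts_gt0 S'.
have cS : #|verts S| = (#|verts S'| + #|verts U|)%N.
  by rewrite eS card_verts_graft.
have vS : root_valency S = (root_valency S').+1.
  by rewrite eS root_valency_graft // eqxx.
have leI := @root_valency_le I.
have IHsize P Q : (#|verts P| + #|verts Q| < #|verts S| + #|verts T|)%N ->
    [disjoint verts P & verts Q] ->
    eval (prelie << P >> << Q >>) = m (eval << P >>) (eval << Q >>).
  move=> lt; apply: IH; apply: leq_trans leST; rewrite /w.
  by move: (leI P); nia.
have IHval P Q : (#|verts P| + #|verts Q| = #|verts S| + #|verts T|)%N ->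
    (root_valency P < root_valency S)%N -> [disjoint verts P & verts Q] ->
    eval (prelie << P >> << Q >>) = m (eval << P >>) (eval << Q >>).
  by move=> e lt; apply: IH; apply: leq_trans leST; rewrite /w e; lia.
have dUT : [disjoint verts U & verts T] by rewrite disjoint_sym.
have dgraft P Q R v : [disjoint verts P & verts R] -> [disjoint verts Q & verts R] ->
    [disjoint verts P & verts Q] -> v \in verts P ->
    [disjoint verts (graft v P Q) & verts R].
  by move=> dPR dQR dPQ vP; rewrite verts_graft // disjointsU dPR.
have eS'T : << S1 >> = prelie << S' >> << T >> - offroot S' T.
  by rewrite prelie_root_graft // eS1 addrK.
have eS'U : << S >> = prelie << S' >> << U >> - offroot S' U.
  by rewrite prelie_root_graft // eS addrK.
(* Grafting off the root keeps the root valency of [S'], one less than that of [S]. *)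
have ev_off P Q : [disjoint verts S' & verts P] -> [disjoint verts S' & verts Q] ->
    [disjoint verts P & verts Q] ->
    (#|verts P| + #|verts Q| = #|verts U| + #|verts T|)%N ->
    eval (prelie (offroot S' P) << Q >>) = m (eval (offroot S' P)) (eval << Q >>).
  move=> dP dQ dPQ c; rewrite /offroot linear_sumlz !linear_sum linear_sumlz.
  apply: eq_bigr => v /andP[vS' vr]; apply: IHval; last exact: dgraft.
    by rewrite (card_verts_graft dP vS') -addnA c addnA -cS.
  by rewrite root_valency_graft // (negbTE vr) vS.
have ev_comp P Q : [disjoint verts S' & verts P] -> [disjoint verts S' & verts Q] ->
    [disjoint verts P & verts Q] ->
    (#|verts P| + #|verts Q| = #|verts U| + #|verts T|)%N ->
    eval (prelie << S' >> (prelie << P >> << Q >>))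
    = m (eval << S' >>) (m (eval << P >>) (eval << Q >>)).
  move=> dP dQ dPQ c; rewrite -IHsize //; last first.
    by rewrite c cS -addnA -add1n leq_add2r.
  rewrite prelieE /graft_sum dPQ linear_sumr !(linear_sum eval) /= linear_sumr.
  apply: eq_bigr => v vP; apply: IHval.
  - by rewrite (card_verts_graft dPQ vP) c addnA -cS.
  - by rewrite vS.
  by rewrite disjoint_sym; apply: dgraft; rewrite // disjoint_sym.
have evS'T : eval (prelie << S' >> << T >>) = m (eval << S' >>) (eval << T >>).
  by apply: IHsize; rewrite // cS ltn_add2r -[ltnLHS]addn0 ltn_add2l.
have evS'U : eval (prelie << S' >> << U >>) = m (eval << S' >>) (eval << U >>).
  by apply: IHsize; rewrite // cS -[ltnLHS]addn0 ltn_add2l.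
(* The order chosen by [root_split]: [S' <| T] is [S1] plus grafts off the root, and [S1 <| U] is
   known by definition. *)
have e1 : eval (prelie (prelie << S' >> << T >>) << U >>)
    = m (m (eval << S' >>) (eval << T >>)) (eval << U >>).
  rewrite -evS'T -[prelie << S' >> << T >>](subrK (offroot S' T)) -eS'T.
  by rewrite linearDl !linearD /= linearDl (eval_split E) ev_off // addnC.
(* The other order, by the pre-Lie identity on both sides. *)
have e2 : eval (prelie (prelie << S' >> << U >>) << T >>)
    = m (m (eval << S' >>) (eval << U >>)) (eval << T >>).
  have -> : prelie (prelie << S' >> << U >>) << T >>
      = (prelie (prelie << S' >> << T >>) << U >>
         - prelie << S' >> (prelie << T >> << U >>))
        + prelie << S' >> (prelie << U >> << T >>).
    by rewrite -prelie_id subrK.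
  rewrite linearD linearB /= e1 !ev_comp // 1?addnC //.
  by rewrite -mP subrK.
rewrite [in LHS]eS'U linearBl linearB /= e2 ev_off // -evS'U -linearBl -linearB.
by rewrite -eS'U.
Qed.

(** The arities are disjoint because [prelie] vanishes on trees with a common vertex, while [m] need
    not. *)
Lemma eval_prelie (J K : {set I}) s t : [disjoint J & K] ->
  PreLie J s -> PreLie K t -> eval (prelie s t) = m (eval s) (eval t).
Proof.
move=> dJK; elim=> [|a _ s' [S SJ <-] _ IHs] Kt.
  by rewrite !(linear0, linear0l).
rewrite !(linearPl, linearP) /= IHs //; congr (_ *: _ + _).
elim: Kt => [|b _ t' [T TK <-] _ IHt]; first by rewrite !(linear0, linear0r).
rewrite !(linearPr, linearP) /= IHt //; congr (_ *: _ + _).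
by apply: eval_prelie_trees; rewrite SJ TK.
Qed.

End Evaluation.

(** * A symplectic pre-Lie algebra of matrices *)

Section SymplecticMatrices.
Variable n : nat.
Local Notation R := 'M[rat]_n.+1.
Local Notation A := (R * R)%type.
Implicit Types x y z : A.

(** The cotangent extension [R (+) R^*] of the associative algebra [R], with
    [R^*] identified with [R] by the trace form. *)
Definition cot_mul (x y : A) : A :=
  (x.1 * y.1, y.2 * x.1 + x.2 * y.1 - y.1 * x.2).

Lemma cot_mul_is_bilinear : bilinear_for *:%R *:%R cot_mul.
Proof.
split=> z a x y; apply: injective_projections => /=.
- by rewrite mulrDl scalerAl.
- rewrite !(mulrDl, mulrDr) -!(scalerAl, scalerAr).
  by apply/matrixP => i j; rewrite !mxE; ring.
- by rewrite mulrDr scalerAr.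
rewrite !(mulrDl, mulrDr) -!(scalerAl, scalerAr).
by apply/matrixP => i j; rewrite !mxE; ring.
Qed.

HB.instance Definition _ := bilinear_isBilinear.Build rat A A A *:%R *:%R
  cot_mul cot_mul_is_bilinear.

Lemma cot_mul_prelie x y z :
  cot_mul (cot_mul x y) z - cot_mul x (cot_mul y z)
  = cot_mul (cot_mul x z) y - cot_mul x (cot_mul z y).
Proof.
apply: injective_projections => /=; first by rewrite !mulrA !subrr.
rewrite !(mulrDl, mulrDr, mulNr, mulrN, mulrA).
by apply/matrixP => i j; rewrite !mxE; ring.
Qed.

(** The canonical symplectic form: second components act on first ones through the trace. *)
Definition cot_form (x y : A) : rat^o := \tr (y.2 * x.1) - \tr (x.2 * y.1).

Lemma cot_form_is_bilinear : bilinear_for *:%R *:%R cot_form.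
Proof.
split=> z a x y; rewrite /cot_form /= !(mulrDl, mulrDr) -!(scalerAl, scalerAr);
  rewrite !mxtraceD !mxtraceZ; set p := \tr _; set q := \tr _;
  set r := \tr _; set s := \tr _; rewrite /GRing.scale /=; ring.
Qed.

HB.instance Definition _ := bilinear_isBilinear.Build rat A A rat^o *:%R *:%R
  cot_form cot_form_is_bilinear.

Lemma cot_formC x y : cot_form x y = -1 *: cot_form y x.
Proof. by rewrite scaleN1r opprB. Qed.

(** Left multiplication by [y] is self-adjoint for the form, by cyclicity of the trace. *)
Lemma cot_form_anti x y z :
  cot_form x (cot_mul y z) + cot_form z (cot_mul y x) = 0.
Proof.
rewrite /cot_form /= !(mulrDl, mulNr, mulrA) !(mxtraceD, raddfN mxtrace) /=.
have tr3 (a b c : R) : \tr (a * b * c) = \tr (b * c * a).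
  by rewrite -mulrA [LHS]mxtrace_mulC.
rewrite (tr3 z.1 y.2) (tr3 x.1 y.2).
ring.
Qed.

(** The form being nondegenerate, this formula recovers the product from its commutator. *)
Lemma cot_form_inv x y z :
  cot_form x (cot_mul y z) = cot_form y (cot_mul x z - cot_mul z x).
Proof.
rewrite linearBr /= /cot_form /= !(mulrDl, mulrDr, mulNr, mulrN, mulrA).
rewrite !(mxtraceD, raddfN mxtrace, opprD, opprK) /=.
have tr3 (a b c : R) : \tr (a * b * c) = \tr (b * c * a).
  by rewrite -mulrA [LHS]mxtrace_mulC.
rewrite (tr3 z.1 y.2) (tr3 x.1 z.2) (tr3 z.1 x.2).
ring.
Qed.

End SymplecticMatrices.

(** * Linear forms on CycPreLie *)

Section CycPreLieForm.
Variables (I : finType) (n : nat) (x : I -> 'M[rat]_n.+1 * 'M[rat]_n.+1).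
Local Notation ev := (eval (@cot_mul n) x).

Definition eval_form (s t : trees I) : rat^o := cot_form (ev s) (ev t).

Lemma eval_form_is_bilinear : bilinear_for *:%R *:%R eval_form.
Proof.
by split=> z a s t; rewrite /eval_form linearP ?(linearPl (@cot_form n)) ?linearPr.
Qed.

HB.instance Definition _ := bilinear_isBilinear.Build rat (trees I) (trees I)
  rat^o *:%R *:%R eval_form eval_form_is_bilinear.

Lemma eval_formC s t : eval_form s t = -1 *: eval_form t s.
Proof. exact: cot_formC. Qed.

(** The arities in [K_P] are disjoint, so [eval] is multiplicative there and the relations become
    [cot_form_anti] and [cot_form_inv]. *)
Lemma eval_form_K_P g : K_P g -> sqlift eval_formC g = 0.
Proof.
have evM := eval_prelie (@cot_mul_prelie n) x.
case=> A B C r s t [_ dAB dAC dBC] Ar Bs Ct.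
  rewrite linearD /= !sqliftE /= /eval_form (evM B C) //.
  by rewrite (evM B A) // 1?disjoint_sym //; apply: cot_form_anti.
rewrite linearB /= !sqliftE /= /eval_form [ev (_ - _)]linearB /=.
rewrite (evM B C) // (evM A C) //.
rewrite (evM C A) // 1?disjoint_sym //.
by rewrite cot_form_inv subrr.
Qed.

Definition cyc_prelie_form : cyc_prelie I -> rat^o := llift eval_form_K_P.

HB.instance Definition _ := GRing.Linear.copy cyc_prelie_form (llift eval_form_K_P).

Lemma cyc_prelie_formE s t :
  cyc_prelie_form (cyc_prelie_pair s t) = cot_form (ev s) (ev t).
Proof. by rewrite /cyc_prelie_form lliftE /= sqliftE. Qed.

End CycPreLieForm.

(** * Left-normed brackets *)

Section LieBasis.
Variable I : finType.
Implicit Types (i a : I) (J K : {set I}) (x y z : free_lie I) (t u : bracketing I).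

Lemma lie_bracket_is_bilinear : bilinear_for *:%R *:%R (@lie_bracket I).
Proof.
split=> z a x y; rewrite -[z]lreprK -[x]lreprK -[y]lreprK -!/(lie_class _).
  by rewrite -linearP !lie_bracketE linearPl linearP.
by rewrite -linearP !lie_bracketE linearPr linearP.
Qed.

HB.instance Definition _ := bilinear_isBilinear.Build rat (free_lie I) (free_lie I)
  (free_lie I) *:%R *:%R (@lie_bracket I) lie_bracket_is_bilinear.

Lemma lie_bracketC x y : lie_bracket x y = - lie_bracket y x.
Proof.
apply/eqP; rewrite -addr_eq0; apply/eqP.
rewrite -[x]lreprK -[y]lreprK -!/(lie_class _) !lie_bracketE -linearD.
exact/lclass_gen/lie_anti.
Qed.

(** The Jacobi identity, oriented to unnest a bracket in the right argument. *)
Lemma lie_bracketA x y z :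
  lie_bracket x (lie_bracket y z)
  = lie_bracket (lie_bracket x y) z - lie_bracket (lie_bracket x z) y.
Proof.
have jac : lie_bracket x (lie_bracket y z) + lie_bracket y (lie_bracket z x)
    + lie_bracket z (lie_bracket x y) = 0.
  rewrite -[x]lreprK -[y]lreprK -[z]lreprK -!/(lie_class _) !lie_bracketE -!linearD.
  exact/lclass_gen/lie_jacobi.
rewrite (lie_bracketC (lie_bracket x y) z) (lie_bracketC (lie_bracket x z) y).
rewrite (lie_bracketC x z) opprK (linearNr (@lie_bracket I)) -opprD addrC.
by apply/eqP; rewrite -addr_eq0 addrA jac.
Qed.

Definition gen (i : I) : free_lie I := lie_class << BLeaf i >>.

Definition left_normed a (s : seq I) : free_lie I :=
  foldl (fun x j => lie_bracket x (gen j)) (gen a) s.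

Lemma left_normed_rcons a s j :
  left_normed a (rcons s j) = lie_bracket (left_normed a s) (gen j).
Proof. by rewrite /left_normed foldl_rcons. Qed.

Definition left_normed_span a J : set (free_lie I) :=
  lspan [set left_normed a s | s in [set s | uniq (a :: s)
                                             && ([set i in a :: s]%SET == J)]].

Lemma left_normed_span_lin a J x y b :
  left_normed_span a J x -> left_normed_span a J y ->
  left_normed_span a J (b *: x + y).
Proof. by move=> lx ly; apply: lspanD => //; apply: lspanZ. Qed.

(** Induction on [t]: a leaf appends one letter, and a node is split by [lie_bracketA]. *)
Lemma left_normed_span_bracket a J t x : uniq (leaves t) ->
  {in leaves t, forall j, j \notin J} -> left_normed_span a J x ->
  left_normed_span a (J :|: [set i in leaves t]) (lie_bracket x (lie_class << t >>)).
Proof.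
elim: t J x => [j|t IHt u IHu] J x /=.
  move=> _ dJ; move: x.
  apply: (lspan_lin (f := fun x => lie_bracket x _)) => [b u v||b u v|].
  - exact: (linearPl (@lie_bracket I)).
  - exact: lspan_0.
  - exact: left_normed_span_lin.
  move=> _ [s /andP[us /eqP sJ] <-]; apply: lspan_gen; exists (rcons s j).
    apply/andP; rewrite -rcons_cons rcons_uniq us andbT; split.
      by have := dJ j (mem_head _ _); rewrite -sJ inE.
    by apply/eqP/setP => k; rewrite -sJ !inE mem_rcons !inE orbCA orbC.
  by rewrite left_normed_rcons.
rewrite cat_uniq => /and3P[ut /hasPn dtu uu] dJ lx.
have dJt : {in leaves t, forall j, j \notin J}.
  by move=> j jt; apply: dJ; rewrite mem_cat jt.
have dJu : {in leaves u, forall j, j \notin J}.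
  by move=> j ju; apply: dJ; rewrite mem_cat ju orbT.
have -> : << BNode t u >> = magma_mul << t >> << u >> by rewrite /magma_mul fglift2_1.
rewrite -lie_bracketE lie_bracketA -[_ - _]addrC -scaleN1r.
apply: left_normed_span_lin.
  rewrite (_ : _ :|: _ = J :|: [set i in leaves u] :|: [set i in leaves t])%SET; last first.
    by apply/setP => k; rewrite !inE mem_cat -orbA [(k \in leaves u) || _]orbC.
  apply: IHt => // [j jt|]; last exact: IHu.
  by rewrite !inE negb_or dJt //=; apply: contraL jt; exact: dtu.
rewrite (_ : _ :|: _ = J :|: [set i in leaves t] :|: [set i in leaves u])%SET; last first.
  by apply/setP => k; rewrite !inE mem_cat -orbA.
apply: IHu => // [j ju|]; last exact: IHt.
by rewrite !inE negb_or dJu //=; exact: dtu.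
Qed.

(** Antisymmetry brings the subtree that contains [a] to the left. *)
Lemma left_normed_span_class a t : uniq (leaves t) -> a \in leaves t ->
  left_normed_span a [set i in leaves t] (lie_class << t >>).
Proof.
elim: t => [j|t IHt u IHu] /=.
  rewrite inE => _ /eqP <-; apply: lspan_gen; exists [::] => //=.
rewrite cat_uniq => /and3P[ut /hasPn dtu uu]; rewrite mem_cat => atu.
have e v w : lie_class << BNode v w >>
    = lie_bracket (lie_class << v >>) (lie_class << w >>).
  by rewrite lie_bracketE /magma_mul fglift2_1.
rewrite e; have [ta|] := boolP (a \in leaves t).
  rewrite (_ : finset _ = [set i in leaves t] :|: [set i in leaves u])%SET; last first.
    by apply/setP => k; rewrite !inE mem_cat.
  apply: left_normed_span_bracket => // [j ju|]; last exact: IHt.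
  by rewrite inE; exact: dtu.
move=> na; move: atu; rewrite (negbTE na) /= => au.
rewrite lie_bracketC -scaleN1r; apply: lspanZ.
rewrite (_ : finset _ = [set i in leaves u] :|: [set i in leaves t])%SET; last first.
  by apply/setP => k; rewrite !inE mem_cat orbC.
apply: left_normed_span_bracket => // [j jt|]; last exact: IHu.
by rewrite inE; apply: contraL jt; exact: dtu.
Qed.

Lemma Lie_left_normed a J x : a \in J -> Lie J x -> left_normed_span a J x.
Proof.
move=> aJ; move: x; apply: (lspan_lin (f := idfun)) => // [|b u v|].
- exact: lspan_0.
- exact: left_normed_span_lin.
move=> _ [t /andP[ut /eqP tJ] <-] /=; rewrite -tJ.
by apply: left_normed_span_class; rewrite // -tJ inE in aJ *.
Qed.

Lemma Lie_gen i : Lie [set i] (gen i).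
Proof.
apply: lspan_gen; exists (BLeaf i) => //; apply/andP; split=> //=.
by apply/eqP/setP => j; rewrite !inE.
Qed.

Lemma Lie_bracket J K x y : [disjoint J & K] -> Lie J x -> Lie K y ->
  Lie (J :|: K) (lie_bracket x y).
Proof.
move=> dJK Jx Ky; move: x Jx.
apply: (lspan_lin (f := fun x => lie_bracket x _)) => [b u v||b u v lu lv|].
- exact: (linearPl (@lie_bracket I)).
- exact: lspan_0.
- by apply: lspanD => //; apply: lspanZ.
move=> _ [t /andP[ut /eqP tJ] <-]; move: y Ky.
apply: (lspan_lin (f := fun x => lie_bracket _ x)) => [b u v||b u v lu lv|].
- exact: (linearPr (@lie_bracket I)).
- exact: lspan_0.
- by apply: lspanD => //; apply: lspanZ.
move=> _ [u /andP[uu /eqP uK] <-]; apply: lspan_gen; exists (BNode t u); last first.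
  by rewrite lie_bracketE /magma_mul fglift2_1.
apply/andP; split=> /=.
  rewrite cat_uniq ut uu andbT; apply/hasPn => j ju.
  have jK : j \in K by rewrite -uK inE.
  by have := disjointFl dJK jK; rewrite -tJ inE => ->.
by rewrite -tJ -uK; apply/eqP/setP => k; rewrite !inE mem_cat.
Qed.

Lemma Lie_left_normed_mem a s : uniq (a :: s) ->
  Lie [set i in a :: s] (left_normed a s).
Proof.
elim/last_ind: s => [|s j IHs].
  move=> _; rewrite (_ : finset _ = [set a]%SET); first exact: Lie_gen.
  by apply/setP => k; rewrite !inE.
rewrite -rcons_cons rcons_uniq left_normed_rcons => /andP[js us].
rewrite (_ : finset _ = [set i in a :: s] :|: [set j])%SET; last first.
  by apply/setP => k; rewrite !inE mem_rcons !inE; case: (k == j); rewrite ?orbT ?orbF.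
apply: Lie_bracket; [|exact: IHs|exact: Lie_gen].
by rewrite disjoint_sym disjoints1 inE.
Qed.

Lemma Lie_set0 x : Lie finset.set0 x -> x = 0.
Proof.
apply: (lspan_lin (f := idfun) (H := [set 0])) => // [b u v -> ->|].
  by rewrite scaler0 addr0.
move=> _ [t /andP[_ /eqP/setP t0] <-].
suff [j jt] : exists j, j \in leaves t by have := t0 j; rewrite !inE jt.
elim: t {t0} => [j|t [j jt] u _] /=; exists j; first exact: mem_head.
by rewrite mem_cat jt.
Qed.

End LieBasis.

(** * CycLie and the detection of Lie elements *)

Section CycLie.
Variable I : finType.
Implicit Types (i a : I) (J : {set I}) (x y z : free_lie I).

Lemma cyc_lie_pair_is_bilinear : bilinear_for *:%R *:%R (@cyc_lie_pair I).
Proof.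
split=> z a x y; rewrite /cyc_lie_pair; first by rewrite linearPl linearP.
by rewrite linearPr linearP.
Qed.

HB.instance Definition _ := bilinear_isBilinear.Build rat (free_lie I) (free_lie I)
  (cyc_lie I) *:%R *:%R (@cyc_lie_pair I) cyc_lie_pair_is_bilinear.

Lemma cyc_lie_pairC x y : cyc_lie_pair x y = cyc_lie_pair y x.
Proof. by rewrite /cyc_lie_pair sqmulC scale1r. Qed.

(** The relation [([x,y],z) = (x,[y,z])] moves the last letter to the right argument, until only [i]
    is left. *)
Lemma cyc_lie_pair_left_normed i s y : uniq (i :: s) ->
  Lie (~: [set j in i :: s]) y ->
  exists2 x, Lie (~: [set i]) x
    & cyc_lie_pair (left_normed i s) y = cyc_lie_pair (gen i) x.
Proof.
elim/last_ind: s y => [|s j IHs] y.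
  move=> _ ly; exists y => //; congr (Lie _ y): ly.
  by apply/setP => k; rewrite !inE.
rewrite -rcons_cons rcons_uniq => /andP[js us] ly; rewrite left_normed_rcons.
pose K := (~: [set k in rcons (i :: s) j])%SET.
have djK : [disjoint [set j] & K].
  by rewrite disjoints1 !inE negbK mem_rcons mem_head orbT.
have [|x lx ex] := IHs (lie_bracket (gen j) y) us.
  rewrite (_ : ~: _ = [set j] :|: K)%SET; first exact: Lie_bracket djK (Lie_gen j) ly.
  apply/setP => k; rewrite !inE mem_rcons !inE.
  by case: (eqVneq k j) => [->|_] /=; first by rewrite inE in js.
exists x => //; rewrite -ex; apply/eqP; rewrite -subr_eq0; apply/eqP.
rewrite /cyc_lie_pair -linearB; apply/lclass_gen.
apply: (@K_L_intro _ [set k in i :: s]%SET [set j]%SET K) => //.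
- split=> //; last first.
  + rewrite disjoint_subset; apply/fintype.subsetP => k; rewrite !inE mem_rcons inE.
    by move=> /orP[->|->]; rewrite ?orbT.
  + by rewrite disjoint_sym disjoints1 inE.
  apply/setP => k; rewrite !inE mem_rcons !inE.
  by case: (k == i); case: (k == j); case: (k \in s).
- exact: Lie_left_normed_mem.
- exact: Lie_gen.
Qed.

(** Existence of [l_i] with [l = (i, l_i)]: by symmetry [i] is in the left factor, which is expanded
    in left-normed brackets starting with [i]. *)
Lemma CycLie_gen i (l : cyc_lie I) : CycLie l ->
  exists2 x, Lie (~: [set i]) x & l = cyc_lie_pair (gen i) x.
Proof.
pose H := [set l : cyc_lie I | exists2 x, Lie (~: [set i]) x
                                & l = cyc_lie_pair (gen i) x]%classic.
have H0 : H 0 by exists 0; [exact: lspan_0 | rewrite linear0r].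
have HD b u v : H u -> H v -> H (b *: u + v).
  move=> [x lx ->] [y ly ->]; exists (b *: x + y); last by rewrite linearPr.
  by apply: lspanD => //; apply: lspanZ.
apply: (lspan_lin (f := idfun) (H := H)) => // _ [J [x [y [Jx Jy ->]]]].
wlog iJ : J x y Jx Jy / i \in J.
  move=> ih; have [|iJ] := boolP (i \in J); first exact: ih Jx Jy.
  by rewrite /= cyc_lie_pairC; apply: (ih (~: J)%SET); rewrite ?finset.setCK ?inE.
move: x {Jx} (Lie_left_normed iJ Jx).
apply: (lspan_lin (f := fun x => cyc_lie_pair x y) (H := H)) => // [b u v|].
  exact: (linearPl (@cyc_lie_pair I)).
move=> _ [s /andP[us /eqP sJ] <-]; apply: cyc_lie_pair_left_normed => //.
by rewrite sJ.
Qed.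

End CycLie.

(** * Coordinates of Lie elements as matrix entries *)

Section Detection.
Variable I : finType.
Implicit Types (i a j : I) (w s : seq I).
Local Notation n := #|I|.

(** Letters of [w] are the consecutive edges of a path 0, 1, ..., [size w]: a product of steps along
    the whole path is nonzero only in the order of [w]. *)
Definition step w j : 'M[rat]_n.+1 :=
  delta_mx (inord (index j w)) (inord (index j w).+1).

(** Evaluating every [j <> i] in the subalgebra [R] and [i] in [R^*] makes the
    form read off a matrix entry of the evaluated Lie polynomial. *)
Definition chain_point i w j : 'M[rat]_n.+1 * 'M[rat]_n.+1 :=
  if j == i then (0, delta_mx (inord (size w)) (inord 0)) else (step w j, 0).

Local Notation ev i w := (eval (@cot_mul n) (chain_point i w)).
Local Notation E k := (delta_mx ord0 (inord k) : 'rV[rat]_n.+1).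

Lemma phi_gen j : phi (gen j) = << single j >>.
Proof. by rewrite /gen phi_class /phi_magma fglift1. Qed.

Lemma ev_gen i w j : i != j -> (ev i w (phi (gen j))).1 = step w j.
Proof.
by move=> ij; rewrite phi_gen eval_tree tree_eval_single /chain_point eq_sym (negbTE ij).
Qed.

Lemma ev_left_normed_rcons i w a s j : i != j -> uniq (rcons (a :: s) j) ->
  (ev i w (phi (left_normed a (rcons s j)))).1 =
  (ev i w (phi (left_normed a s))).1 *m step w j
  - step w j *m (ev i w (phi (left_normed a s))).1.
Proof.
rewrite rcons_uniq => ij /andP[js us]; rewrite left_normed_rcons phi_bracket.
rewrite /prelie_comm [ev i w (_ - _)]linearB /=.
have la := phi_PreLie (Lie_left_normed_mem us).
have lj := phi_PreLie (Lie_gen j).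
have d : [disjoint [set k in a :: s] & [set j]].
  by rewrite disjoint_sym disjoints1 inE.
have evM := eval_prelie (@cot_mul_prelie n) (chain_point i w).
by rewrite (evM _ _ _ _ d la lj) (evM _ _ _ _ _ lj la) 1?disjoint_sym //= !ev_gen.
Qed.

Lemma row_step w j k : uniq w -> j \in w -> (k <= n)%N ->
  E k *m step w j = if k == index j w then E k.+1 else 0.
Proof.
move=> uw jw kn; rewrite mul_delta_mx_cond -val_eqE /= inordK ?ltnS // inordK.
  by case: eqP => [->|]; rewrite ?mulr1n ?mulr0n.
by rewrite ltnS (leq_trans (index_size _ _)) // -(card_uniqP uw) max_card.
Qed.

(** Only the step of [a] leaves vertex 0, so of all the words in the expanded bracket only [a :: s]
    survives, and it must follow the path. *)
Lemma row_left_normed i a w s : uniq (a :: w) -> uniq (a :: s) -> i \notin a :: w ->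
  {subset s <= w} -> (size s <= size w)%N ->
  E 0 *m (ev i (a :: w) (phi (left_normed a s))).1
  = if a :: s == take (size s).+1 (a :: w) then E (size s).+1 else 0.
Proof.
move=> uw us iw; have szw : (size (a :: w) <= n)%N.
  by rewrite -(card_uniqP uw) max_card.
have ni j : j \in a :: w -> i != j by move=> jw; apply: contraNneq iw => ->.
elim/last_ind: s us => [|s j IHs] us sw sz.
  rewrite /left_normed /= take0 eqxx ev_gen ?ni ?mem_head //.
  by rewrite row_step ?mem_head //= eqxx.
have jw : j \in a :: w by rewrite inE sw ?orbT // mem_rcons mem_head.
have [us' ja] : uniq (a :: s) /\ j != a.
  by move: us; rewrite -rcons_cons rcons_uniq inE negb_or => /andP[/andP[]].
rewrite size_rcons in sz *; have ltsz : (size s < size w)%N by [].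
(* This kills the second term of the commutator with [j]. *)
have row0 : E 0 *m step (a :: w) j = 0.
  by rewrite row_step //= [a == j]eq_sym (negbTE ja).
rewrite ev_left_normed_rcons ?ni // mulmxBr !mulmxA row0 mul0mx subr0.
rewrite IHs ?(ltnW ltsz) //; last by move=> k ks; rewrite sw // mem_rcons inE ks orbT.
rewrite [in RHS](take_nth j) // -rcons_cons eqseq_rcons.
case: ifP => _; last by rewrite mul0mx.
rewrite row_step // ?(leq_trans _ szw) //; last exact: ltnW.
congr (if _ then _ else _).
by apply/eqP/eqP => [->|->]; rewrite ?nth_index ?index_uniq.
Qed.

(** The entry (0, [size w]) of the evaluated [x]. The sign compensates [cot_form], whose first
    argument here lies in [R^*]. *)
Definition coef_form i w (x : free_lie I) : rat^o :=
  - cyc_prelie_form (chain_point i w) (cyc_prelie_pair << single i >> (phi x)).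

Lemma coef_form_is_linear i w : linear (coef_form i w).
Proof.
by move=> b x y; rewrite /coef_form linearP linearPr linearP opprD scalerN.
Qed.

HB.instance Definition _ i w := GRing.isLinear.Build rat (free_lie I) rat^o _
  (coef_form i w) (coef_form_is_linear i w).

Lemma coef_form_left_normed i a w s : uniq (a :: w) -> i \notin a :: w ->
  perm_eq s w -> coef_form i (a :: w) (left_normed a s) = (s == w)%:R.
Proof.
move=> uw iw sw; have sz := perm_size sw.
have us : uniq (a :: s) by rewrite /= (perm_mem sw) (perm_uniq sw).
rewrite /coef_form cyc_prelie_formE /cot_form.
rewrite eval_tree tree_eval_single [chain_point _ _ i]/chain_point eqxx /=.
rewrite mulr0 mxtrace0 sub0r opprK.
(* The elementary matrix is a column times a row; rotating the trace exposes the row treated by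
   [row_left_normed]. *)
rewrite -[delta_mx _ _](@mul_delta_mx _ _ 1 _ ord0) -[_ * _]mulmxA mxtrace_mulC.
rewrite row_left_normed // ?sz // => [|j]; last by rewrite (perm_mem sw).
rewrite [take _ _]take_oversize // eqseq_cons eqxx /=.
case: eqP => _; last by rewrite mul0mx mxtrace0.
by rewrite mul_delta_mx trace_mx11 mxE eqxx.
Qed.

(** The forms [coef_form i (a :: w)] are dual to the left-normed brackets starting with [a], so they
    give the coordinates of [x]; they depend on [x] only through the pairing. *)
Lemma cyc_prelie_pair_phi_inj i x : Lie (~: [set i]) x ->
  cyc_prelie_pair << single i >> (phi x) = 0 -> x = 0.
Proof.
(* Without a letter other than [i], there is no [a] to start from, but Lie of the empty set is 0. *)
have [J0|[a aJ]] := finset.set_0Vmem (~: [set i])%SET.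
  by rewrite J0 => /Lie_set0.
move=> /(Lie_left_normed aJ) lx x0.
pose p := permutations (enum (~: [set i] :\ a)%SET).
have pP s : s \in p = perm_eq s (enum (~: [set i] :\ a)%SET).
  by rewrite mem_permutations.
have pw s : s \in p -> uniq (a :: s) /\ i \notin a :: s.
  rewrite pP => sJ; rewrite /= (perm_uniq sJ) enum_uniq !inE !(perm_mem sJ).
  rewrite !mem_enum !inE !eqxx andbF orbF; split=> //.
  by move: aJ; rewrite !inE eq_sym.
have psp s : uniq (a :: s) -> ([set k in a :: s]%SET == ~: [set i])%SET -> s \in p.
  move=> /= /andP[nas us] /eqP/setP es; rewrite pP; apply: uniq_perm => //.
    exact: enum_uniq.
  move=> k; rewrite mem_enum inE -es !inE; case: eqVneq => //= ->.
  exact: negbTE.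
have D : x = \sum_(w <- p) coef_form i (a :: w) x *: left_normed a w.
  elim: lx => [|b _ y [s /andP[us sJ] <-] _ IH].
    by rewrite big1 // => w _; rewrite linear0 scale0r.
  have sp := psp s us sJ.
  transitivity (\sum_(w <- p) (b * (s == w)%:R) *: left_normed a w
     + \sum_(w <- p) coef_form i (a :: w) y *: left_normed a w).
    rewrite -IH; congr (_ + _); rewrite (bigD1_seq s) ?permutations_uniq //=.
    rewrite eqxx mulr1 big1 ?addr0 // => w ws.
    by rewrite eq_sym (negbTE ws) mulr0 scale0r.
  rewrite -big_split /= !big_seq; apply: eq_bigr => w wp.
  have [uw iw] := pw w wp.
  rewrite linearP /= coef_form_left_normed // ?scalerDl //.
  by move: sp wp; rewrite !pP => sp wp; rewrite (perm_trans sp) // perm_sym.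
rewrite D big1 // => w _.
by rewrite /coef_form x0 linear0 oppr0 scale0r.
Qed.

End Detection.

(** * Injectivity of lambda *)

Section RootComponents.
Variable I : finType.
Implicit Types (i a : I) (T : rtree I) (s : trees I).

Lemma disjoint_single i T : verts T = (~: [set i])%SET ->
  [disjoint verts (single i) & verts T].
Proof. by move=> ->; rewrite disjoints1 !inE eqxx. Qed.

Lemma prelie_single i T : verts T = (~: [set i])%SET ->
  prelie << single i >> << T >> = << graft i (single i) T >>.
Proof. by move=> vT; rewrite prelieE /graft_sum disjoint_single // big_set1. Qed.

Lemma prelie_single_v1 i s : PreLie (~: [set i])%SET s ->
  PreLie_v1 [set: I]%SET (prelie << single i >> s).
Proof.
move: s; apply: (lspan_lin (linearPr (@prelie I) _)) => [|b u v lu lv|].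
- exact: lspan_0.
- by apply: lspanD => //; apply: lspanZ.
move=> _ [T vT <-] /=; rewrite prelie_single //.
have iS : i \in verts (single i) by rewrite inE.
have dT := disjoint_single vT.
apply: lspan_gen; exists (graft i (single i) T) => //; split.
  by rewrite verts_graft // vT finset.setUCr.
by rewrite root_valency_graft // eqxx root_valency_single.
Qed.

(** A left inverse of [i <| _] that kills [a <| _] for [a != i]: it isolates one summand of
    [psi]. *)
Definition root_branch i : trees I -> trees I := fglift (fun W =>
  if [pick T | (verts T == ~: [set i])%SET && (graft i (single i) T == W)]
  is Some T then << T >> else 0).

HB.instance Definition _ i := GRing.Linear.copy (root_branch i) (fglift _).

Lemma root_branch_prelie i a s : PreLie (~: [set a])%SET s ->
  root_branch i (prelie << single a >> s) = if i == a then s else 0.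
Proof.
elim=> [|b _ s' [T vT <-] _ IH]; first by rewrite linear0r linear0 if_same.
rewrite linearPr linearP /= IH prelie_single // /root_branch fglift1.
have iS j : j \in verts (single j) by rewrite inE.
have dT := disjoint_single vT.
case: pickP => [W /andP[/eqP vW /eqP eW]|none].
  have dW := disjoint_single vW.
  have := congr1 (@root I) eW; rewrite !root_graft // => eia.
  rewrite /root /= in eia; subst a; rewrite eqxx; congr (_ *: << _ >> + _).
  have [e|ne] := eqVneq (root W) (root T).
    by have [_] := root_graft_inj dW dT eW e.
  (* Distinct roots would make the branches disjoint, yet they have the same nonempty vertex set. *)
  have := root_graft_disjoint dW dT eW ne.
  rewrite vW -vT; have [rT _ _ _ _] := rtreeP T.
  by move/disjointFr/(_ rT); rewrite rT.
case: eqVneq => [eia|_]; last by rewrite scaler0 addr0.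
by have := none T; rewrite eia vT !eqxx.
Qed.

Lemma Gamma_PreLie i t : PreLie (~: [set i])%SET (Gamma i t).
Proof.
(* The default value 0 also lies in the span. *)
rewrite /Gamma; case: xgetP => [s _ [] //|_]; exact: lspan_0.
Qed.

Lemma root_branch_lambda i (l : cyc_lie I) :
  root_branch i (lambda l) = Gamma i (theta l i).
Proof.
rewrite /lambda /psi linear_sum (bigD1 i) //=.
rewrite root_branch_prelie ?eqxx; last exact: Gamma_PreLie.
rewrite big1 ?addr0 // => a ai; rewrite root_branch_prelie; last exact: Gamma_PreLie.
by rewrite eq_sym (negbTE ai).
Qed.

(** Each tree [T_b] of [phi x] has root [b != i], so [(i - b) (x) <i, T_b>] has component [<i, T_b>]
    at [i]. *)
Lemma theta_gen i x : Lie (~: [set i])%SET x ->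
  theta (cyc_lie_pair (gen i) x) i = cyc_prelie_pair << single i >> (phi x).
Proof.
move=> /phi_PreLie; rewrite thetaE phi_gen => lx.
pose D s := theta_bilin << single i >> s i - cyc_prelie_pair << single i >> s.
have DL : linear D.
  have thetaL b u v : theta_bilin << single i >> (b *: u + v)
      = b *: theta_bilin << single i >> u + theta_bilin << single i >> v.
    by rewrite /theta_bilin /fglift2 !fglift1 fglift_is_linear.
  have pairL := linearPr (@cyc_prelie_pair I) << single i >>.
  by move=> b u v; rewrite /D thetaL pairL !ffunE opprD scalerBr addrACA.
apply/eqP; rewrite -subr_eq0; apply/eqP; move: lx.
apply: (lspan_lin (H := [set 0]%classic) DL) => // [b u v -> ->|_ [T vT <-]].
  by rewrite scaler0 addr0.
have [rT _ _ _ _] := rtreeP T.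
rewrite /D /= /theta_bilin fglift2_1 !ffunE eqxx.
have /negbTE -> : i != root T by apply: contraTneq rT => <-; rewrite vT !inE eqxx.
by rewrite subr0 scale1r subrr.
Qed.

(** [phi x], where [l = (i, x)], witnesses that the choice in [Gamma] succeeds. *)
Lemma Gamma_theta i (l : cyc_lie I) : CycLie l ->
  theta l i = cyc_prelie_pair << single i >> (Gamma i (theta l i)).
Proof.
move=> /(CycLie_gen i)[x lx ->]; rewrite theta_gen // /Gamma.
by case: xgetP => [s _ [] //|/(_ (phi x))[]]; split=> //; exact: phi_PreLie.
Qed.

End RootComponents.

Unset Implicit Arguments.

Theorem proposition9p1 (I : finType) :
  (forall l : cyc_lie I, CycLie l -> PreLie_v1 [set: I]%SET (lambda l)) /\
  {in @CycLie I &, injective (@lambda I)}.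
Proof.
split=> [l _|l l' /set_mem ll /set_mem ll' eqL].
  by apply: lspan_sum => a _; apply/prelie_single_v1/Gamma_PreLie.
(* On the empty set CycLie is 0. *)
have [i _|I0] := pickP I; last first.
  have z (k : cyc_lie I) : CycLie k -> k = 0.
    apply: (lspan_lin (f := idfun) (H := [set 0]%classic)) => // [b u v -> ->|].
      by rewrite scaler0 addr0.
    move=> _ [J [x [y [Jx _ ->]]]] /=; rewrite (_ : x = 0); first exact: linear0l.
    by apply: Lie_set0; congr (Lie _ x): Jx; apply/setP => j; have := I0 j.
  by rewrite (z l ll) (z l' ll').
(* [root_branch i] recovers [Gamma i (theta l i)] from [lambda l], and pairing with [i] recovers
   [theta l i]. *)
have e : theta l i = theta l' i.
  by rewrite (Gamma_theta i ll) (Gamma_theta i ll') -!root_branch_lambda eqL.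
have [x lx el] := CycLie_gen i ll; have [y ly el'] := CycLie_gen i ll'.
rewrite el el'; congr cyc_lie_pair; apply/eqP; rewrite -subr_eq0; apply/eqP.
apply: (@cyc_prelie_pair_phi_inj I i).
  by rewrite -scaleN1r; apply: lspanD => //; apply: lspanZ.
rewrite [phi (_ - _)]linearB /= linearBr /= -(theta_gen lx) -(theta_gen ly).
by rewrite -el -el' e subrr.
Qed.
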